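(* Suppose $n\ge 3$ is an integer. Let $$r_n=\min_{x\in(0,1/n)} f_n(x),\quad\text{where}\quad f_n(x)=(1+x)^n\bigl(1-n\ln(x)\bigr).$$ Then $$\theta(K)\le r_n\ \text{ for any } K\in\mathcal{K}_n,\qquad H_n\le\binom{2n}{n}r_n,\qquad\text{and}\qquad H_n^s\le 2^n r_n.$$
   Context: $\mathbb{E}^n$ denotes $n$-dimensional Euclidean space. $\mathcal{K}_n$ is the family of all convex bodies in $\mathbb{E}^n$, i.e., all convex compact sets $K\subset\mathbb{E}^n$ with nonempty interior $\mathrm{int}(K)$. $\mathcal{K}_n^s$ is the subfamily of $\mathcal{K}_n$ consisting of centrally symmetric convex bodies. For $A,B\subset\mathbb{E}^n$, let $$C(A,B):=\min\left\{N:\exists\, t_1,\dots,t_N\in\mathbb{E}^n \text{ satisfying } A\subset\bigcup_{j=1}^N (t_j+B)\right\}$$ be the minimal number of translates of $B$ needed to cover $A$. Define $$H_n=\max\{C(K,\mathrm{int}(K)):K\in\mathcal{K}_n\},\qquad H_n^s=\max\{C(K,\mathrm{int}(K)):K\in\mathcal{K}_n^s\}.$$ For $L\in\mathcal{K}_n$, the covering density of space by translates of $L$ is $$\theta(L)=\lim_{R\to\infty}\inf_{\Lambda}\left\{\frac{|L|\,\#\Lambda}{(2R)^n}:\ [-R,R]^n\subset\bigcup_{\lambda\in\Lambda}(x_\lambda+L)\right\},$$ where $|L|$ is the $n$-dimensional volume of $L$, the infimum is over finite index sets $\Lambda$ and points $x_\lambda\in\mathbb{E}^n$ ($\lambda\in\Lambda$)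 for which the covering holds, and $\#\Lambda$ is the cardinality of $\Lambda$. *)

(* Defs.v *)
From HB Require Import structures.
From mathcomp Require Import all_boot all_order all_algebra.
From mathcomp Require Import all_classical all_reals all_analysis.

Set Implicit Arguments.
Unset Strict Implicit.
Unset Printing Implicit Defensive.

Import Order.TTheory GRing.Theory Num.Theory.
Import numFieldNormedType.Exports.

Local Open Scope classical_set_scope.
Local Open Scope ring_scope.

(* Euclidean n-space is 'rV[R]_n.  Its canonical norm in the library is the sup
   norm, but only the induced topology (compactness, interior) is used below. *)

Definition is_minimum d (T : porderType d) (S : set T) (m : T) : Prop :=
  S m /\ lbound S m.

Definition is_maximum d (T : porderType d) (S : set T) (m : T) : Prop :=
  S m /\ ubound S m.

(* The n-fold product of the one-dimensional Lebesgue measure, transported from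
   R * m.-tuple R to m.+1.-tuple R.  measurableTypeR R is R with the Borel
   sigma-algebra on which lebesgue_measure is defined. *)
Fixpoint tuple_lebesgue (R : realType) (n : nat) :
    set (n.-tuple (measurableTypeR R)) -> \bar R :=
  match n with
  | 0 => dirac (nil_tuple (measurableTypeR R))
  | m.+1 => fun A =>
      ((@lebesgue_measure R) \x (@tuple_lebesgue R m))%E
        [set p : measurableTypeR R * m.-tuple (measurableTypeR R)
        | A (cons_tuple p.1 p.2)]
  end.

Definition volume (R : realType) (n : nat) (A : set 'rV[R]_n) : \bar R :=
  tuple_lebesgue [set t : n.-tuple (measurableTypeR R) | A (\row_i (tnth t i : R))].

Definition convex_body (R : realType) (n : nat) (K : set 'rV[R]_n) : Prop :=
  [/\ convex_set K, compact K & K° !=set0].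

Definition centrally_symmetric (R : realType) (n : nat) (K : set 'rV[R]_n) :
    Prop :=
  exists c : 'rV[R]_n, forall x, K x -> K (2%:R *: c - x).

Definition symmetric_convex_body (R : realType) (n : nat) (K : set 'rV[R]_n) :
    Prop :=
  convex_body K /\ centrally_symmetric K.

Definition covered_by_translates (R : realType) (n : nat)
    (A B : set 'rV[R]_n) (N : nat) : Prop :=
  exists t : 'I_N -> 'rV[R]_n, A `<=` \bigcup_j [set t j + b | b in B].

(* C(A, B); the infimum of a nonempty set of natural numbers is attained, and
   the value is +oo when no finite number of translates suffices. *)
Definition covering_number (R : realType) (n : nat) (A B : set 'rV[R]_n) :
    \bar R :=
  ereal_inf [set (N%:R)%:E | N in covered_by_translates A B].

Definition interior_covering_numbers (R : realType) (n : nat)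
    (F : set (set 'rV[R]_n)) : set (\bar R) :=
  [set covering_number K (K°) | K in F].

(* H_n and H_n^s: the theorem asserts that these suprema are maxima. *)
Definition hadwiger_number (R : realType) (n : nat) : \bar R :=
  ereal_sup (interior_covering_numbers (@convex_body R n)).

Definition symmetric_hadwiger_number (R : realType) (n : nat) : \bar R :=
  ereal_sup (interior_covering_numbers (@symmetric_convex_body R n)).

Definition cube (R : realType) (n : nat) (s : R) : set 'rV[R]_n :=
  [set v | forall i, - s <= v ord0 i <= s].

(* A finite index set is taken to be 'I_N, with N its cardinality. *)
Definition cube_covering_density (R : realType) (n : nat) (L : set 'rV[R]_n)
    (s : R) : \bar R :=
  ereal_inf [set (volume L * (N%:R / (2%:R * s) ^+ n)%:E)%E
            | N in covered_by_translates (@cube R n s) L].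

(* theta(L); lim is meaningful only together with the convergence of the
   cube densities, which the theorem asserts as well. *)
Definition covering_density (R : realType) (n : nat) (L : set 'rV[R]_n) :
    \bar R :=
  lim (cube_covering_density L s @[s --> +oo]).

Definition rogers_fun (R : realType) (n : nat) (x : R) : R :=
  (1 + x) ^+ n * (1 - n%:R * ln x).

Definition rogers_values (R : realType) (n : nat) : set R :=
  [set rogers_fun n x | x in `]0, n%:R^-1[].

(* r_n: the theorem asserts that this infimum is a minimum. *)
Definition rogers_bound (R : realType) (n : nat) : R :=
  inf (@rogers_values R n).

Arguments convex_body : clear implicits.
Arguments symmetric_convex_body : clear implicits.
Arguments hadwiger_number : clear implicits.
Arguments symmetric_hadwiger_number : clear implicits.
Arguments rogers_values : clear implicits.
Arguments rogers_bound : clear implicits.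

(* Main.v *)
(* All volumes are computed by counting points of the lattice h Z^n as h tends
   to 0; the Lebesgue measure only enters through the bound of volume by this
   content.  After a translation, - eta K is contained in K for the minimizer
   eta < 1/n of f_n.  Rogers' covering bound: translates of K chosen greedily
   leave at most a proportion eta^n of a large cube uncovered once their density
   reaches n ln (1/eta); a maximal packing of the rest by translates of - eta K
   adds density at most 1, and all translates become a covering after
   enlargement by the factor 1 + eta.  The number of translates of int K needed
   to cover K is then bounded by averaging over the translates of K inside a
   large cube (Rogers-Zong), which gives |K - K| / |K| times the covering
   density, and |K - K| is bounded by the Rogers-Shephard inequality, or equals
   2^n |K| if K is symmetric. *)
Require Import Defs.
From HB Require Import structures.
From mathcomp Require Import all_boot all_order all_algebra.
From mathcomp Require Import perm finmap.
From mathcomp Require Import all_classical all_reals all_analysis.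
From mathcomp Require Import measurable_realfun.
From mathcomp Require Import ring lra zify.

Set Implicit Arguments.
Unset Strict Implicit.
Unset Printing Implicit Defensive.

Import Order.TTheory GRing.Theory Num.Theory.
Import numFieldNormedType.Exports.

Local Open Scope classical_set_scope.
Local Open Scope ring_scope.

(** * Greedy coverings in abelian groups *)

Section Finite.
Local Open Scope fset_scope.
Local Open Scope ring_scope.

(** Counting replaces measure because greedy selection, maximal packing and the averaging arguments
    then concern finite subsets of an abelian group, where only cardinalities matter. The price is
    rounding to the lattice, which moves a point by less than h in each coordinate. A dilation by 1
    + d of a body containing a cube around 0 absorbs this error, so it surfaces only as a power of 1
    + d whose exponent depends on n alone, and d tends to 0 at the end. An upper bound for the
    Lebesgue volume suffices: the volume is a factor of the covering density, to be bounded above,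
    while in the Hadwiger numbers only a ratio of contents appears. The condition eta < 1/n is tied
    to the choice of the center: at ratio 1/n the barycentric argument would require a simplex of
    exactly maximal volume, and the strict inequality leaves room for one that is only almost
    maximal. *)

Lemma card_le_inj (T U : choiceType) (X : {fset T}) (Y : {fset U}) (f : T -> U) :
  {in X &, injective f} -> {in X, forall x, f x \in Y} -> (#|` X| <= #|` Y|)%N.
Proof.
move=> fI fY; rewrite -(card_in_imfset imfset_key fI).
by apply/fsubset_leq_card/fsubsetP => y /imfsetP[x /= xX ->]; exact: fY.
Qed.

Lemma card_fset_sum (T : choiceType) (Z : {fset T}) (P : pred T) :
  #|` [fset z in Z | P z]| = (\sum_(z <- Z) P z)%N.
Proof. by rewrite card_fset_sum1 big_fset big_mkcond; apply: eq_bigr => z _; case: (P z). Qed.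

Lemma sum_card_exchange (T U : choiceType) (X : {fset T}) (Y : {fset U})
    (e : T -> U -> bool) :
  (\sum_(x <- X) #|` [fset y in Y | e x y]|
   = \sum_(y <- Y) #|` [fset x in X | e x y]|)%N.
Proof.
under eq_bigr do rewrite card_fset_sum.
by rewrite exchange_big /=; under [RHS]eq_bigr do rewrite card_fset_sum.
Qed.

Lemma sum_fset_le (T : choiceType) (X : {fset T}) (F : T -> nat) c :
  {in X, forall x, F x <= c}%N -> (\sum_(x <- X) F x <= #|` X| * c)%N.
Proof.
move=> Fc; rewrite card_fset_sum1 big_distrl /= [X in (X <= _)%N]big_seq.
by rewrite [X in (_ <= X)%N]big_seq; apply: leq_sum => x /Fc; rewrite mul1n.
Qed.

Lemma sum_fset_ge (T : choiceType) (X : {fset T}) (F : T -> nat) c :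
  {in X, forall x, c <= F x}%N -> (#|` X| * c <= \sum_(x <- X) F x)%N.
Proof.
move=> Fc; rewrite card_fset_sum1 big_distrl /= [X in (X <= _)%N]big_seq.
by rewrite [X in (_ <= X)%N]big_seq; apply: leq_sum => x /Fc; rewrite mul1n.
Qed.

Lemma exists_le_average (T : choiceType) (X : {fset T}) (F : T -> nat) c :
  X != fset0 -> (\sum_(x <- X) F x <= c)%N ->
  exists2 x, x \in X & (#|` X| * F x <= c)%N.
Proof.
move=> X0 Fc; apply: contrapT => H.
have {}H x : x \in X -> (c < #|` X| * F x)%N.
  by move=> xX; rewrite ltnNge; apply/negP => h; apply: H; exists x.
have : (#|` X| * c.+1 <= #|` X| * \sum_(x <- X) F x)%N.
  by rewrite big_distrr /=; apply: sum_fset_ge => x /H.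
by rewrite leq_pmul2l ?cardfs_gt0// => /leq_trans /(_ Fc); rewrite ltnn.
Qed.

Lemma exists_ge_average (T : choiceType) (X : {fset T}) (F : T -> nat) c :
  X != fset0 -> (c <= \sum_(x <- X) F x)%N ->
  exists2 x, x \in X & (c <= #|` X| * F x)%N.
Proof.
move=> X0 Fc; apply: contrapT => H.
have {}H x : x \in X -> (#|` X| * F x < c)%N.
  by move=> xX; rewrite ltnNge; apply/negP => h; apply: H; exists x.
have c0 : (0 < c)%N by have [x /H] := fset0Pn _ X0; exact: leq_trans.
have : (#|` X| * \sum_(x <- X) F x <= #|` X| * c.-1)%N.
  by rewrite big_distrr /=; apply: sum_fset_le => x /H; case: (c) c0.
rewrite leq_pmul2l ?cardfs_gt0// => /(leq_trans Fc).
by case: (c) c0 => // k _; rewrite ltnn.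
Qed.

Section Covering.
Variable G : zmodType.
Implicit Types (P Q D U : {fset G}) (t : seq G).

Definition uncovered Q D t := [fset q in Q | all (fun x => q - x \notin D) t].

(** For fixed u, the map d |-> u - d embeds D into Q', so over g in Q' the translates g + D contain
    on average at least #|U| #|D| / #|Q'| points of the uncovered set U. A best g shrinks U by the
    factor 1 - #|D| / #|Q'|. *)
Lemma greedy_cover (R : realType) Q Q' D N :
  {in Q & D, forall q d, q - d \in Q'} -> Q' != fset0 -> exists t, size t = N /\
    #|` uncovered Q D t|%:R
      <= (1 - #|` D|%:R / #|` Q'|%:R) ^+ N * #|` Q|%:R :> R.
Proof.
move=> QD Q'0; elim: N => [|N [t [st IH]]].
  exists [::]; split => //; rewrite expr0 mul1r ler_nat.
  by apply/fsubset_leq_card/fsubsetP => q; rewrite !inE => /andP[].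
set U := uncovered Q D t in IH *.
have [g _ Hg] : exists2 g, g \in Q' &
    (#|` U| * #|` D| <= #|` Q'| * #|` [fset u in U | (u - g)%R \in D]|)%N.
  apply: exists_ge_average => //; rewrite sum_card_exchange.
  apply: sum_fset_ge => u; rewrite !inE => /andP[/= uQ _].
  apply: (@card_le_inj _ _ _ _ (fun d => u - d)) => [d d' _ _ /addrI/oppr_inj //|d dD].
  by rewrite !inE /= QD//= opprB addrC subrK.
exists (g :: t); split; first by rewrite /= st.
have UE : (#|` uncovered Q D (g :: t)| + #|` [fset u in U | (u - g)%R \in D]| = #|` U|)%N.
  rewrite -(cardfsID [fset u in U | u - g \in D] U) addnC; congr (_ + _)%N.
    congr (#|` _|); apply/fsetP => x; rewrite !inE /=.
    by case: (x \in Q); case: (x - g \in D); case: (all _ _).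
  congr (#|` _|); apply/fsetP => x; rewrite !inE /=.
  by case: (x \in Q); case: (x - g \in D); case: (all _ _).
have Q'p : 0 < #|` Q'|%:R :> R by rewrite ltr0n cardfs_gt0.
have : #|` uncovered Q D (g :: t)|%:R <= (1 - #|` D|%:R / #|` Q'|%:R) * #|` U|%:R :> R.
  have -> : #|` uncovered Q D (g :: t)|%:R
      = #|` U|%:R - #|` [fset u in U | u - g \in D]|%:R :> R.
    by rewrite -UE natrD addrK.
  rewrite mulrBl mul1r lerD2l lerN2 mulrAC ler_pdivrMr//.
  by rewrite -!natrM ler_nat mulnC [leqRHS]mulnC.
move=> /le_trans; apply; rewrite exprS -mulrA.
(* Multiplying the induction hypothesis by 1 - #|D| / #|Q'| requires this factor to be nonnegative.
   A point u of Q gives an injection of D into Q'; if Q is empty, both sides vanish. *)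
have [Q0|Q0] := eqVneq Q fset0.
  suff -> : #|` U| = 0%N by rewrite Q0 cardfs0 !mulr0.
  by apply/eqP; rewrite cardfs_eq0; apply/eqP/fsetP => x; rewrite !inE /= Q0 inE.
apply: ler_wpM2l => //; rewrite subr_ge0 ler_pdivrMr// mul1r ler_nat.
have [u uQ] := fset0Pn _ Q0.
by apply: (@card_le_inj _ _ _ _ (fun d => u - d)) => [d d' _ _ /addrI/oppr_inj //|d dD]; exact: QD.
Qed.

(** Remove from U one translate y + P contained in it and recurse on the rest. A translate z + P
    inside U either meets the removed one or lies in the remainder; each removal takes exactly #|P|
    points, whence the size bound. *)
Lemma maximal_packing P U : P != fset0 -> exists2 t, (size t * #|` P| <= #|` U|)%N &
  forall z, {in P, forall p, z + p \in U} ->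
    exists p p' y, [/\ p \in P, p' \in P, y \in t & z + p = y + p'].
Proof.
move=> P0; have [k] := ubnP #|` U|; elim: k U => // k IH U Uk.
have [[y yU]|H] := pselect (exists y, {in P, forall p, y + p \in U}); last first.
  by exists [::] => // z zU; case: H; exists z.
pose Y := [fset y + p | p in P].
have YU : Y `<=` U by apply/fsubsetP => x /imfsetP[p /= pP ->]; exact: yU.
have cY : #|` Y| = #|` P| by rewrite card_imfset //=; exact: addrI.
have UE : (#|` U `\` Y| + #|` P| = #|` U|)%N.
  by rewrite -cY cardfsD (fsetIidPr YU) subnK// fsubset_leq_card.
have P1 : (0 < #|` P|)%N by rewrite cardfs_gt0.
have [|t tU tP] := IH (U `\` Y).
  by rewrite -ltnS; apply: leq_trans Uk; rewrite ltnS -UE -addn1 leq_add2l.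
exists (y :: t) => [|z zU]; first by rewrite /= mulSn addnC -UE leq_add2r.
have [zY|] := pselect (exists2 p, p \in P & z + p \in Y).
  have [p pP /imfsetP[p' /= p'P e]] := zY.
  by exists p, p', y; rewrite !inE eqxx; split.
move=> zY; have [|p [p' [x [? ? xt ?]]]] := tP z; last first.
  by exists p, p', x; rewrite !inE xt orbT; split.
by move=> p pP; rewrite !inE zU// andbT; apply/negP => h; apply: zY; exists p.
Qed.

(** Either some point of z + P lies in a greedy translate x + D, or all of z + P is uncovered and
    meets a packed translate x + P. In both cases z is in x + d - P for some d in D or P, which is
    the enlarged translate. *)
Lemma greedy_packing_cover (R : realType) Q Q' D P N :
  {in Q & D, forall q d, q - d \in Q'} -> P != fset0 -> Q' != fset0 ->
  exists t : seq G,
    (size t)%:R <= N%:R + (1 - #|` D|%:R / #|` Q'|%:R) ^+ N * #|` Q|%:R / #|` P|%:R :> R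
    /\ forall z, {in P, forall p, z + p \in Q} ->
       exists x p d, [/\ x \in t, p \in P, d \in D `|` P & z + p = x + d].
Proof.
move=> QD P0 Q'0.
have [t [tN tU]] := greedy_cover R N QD Q'0.
have [t' t'U t'P] := maximal_packing (uncovered Q D t) P0.
exists (t ++ t'); split=> [|z zQ].
  rewrite size_cat natrD tN lerD2l ler_pdivlMr ?ltr0n ?cardfs_gt0//.
  by apply: le_trans tU; rewrite -natrM ler_nat.
have [zU|] := pselect {in P, forall p, z + p \in uncovered Q D t}.
  have [p [p' [y [? p'P yt ?]]]] := t'P _ zU.
  by exists y, p, p'; rewrite mem_cat yt orbT inE p'P orbT.
move=> /existsNP[p /not_implyP[pP]]; rewrite !inE zQ//= => /negP/allPn[x xt].
rewrite negbK => zD; exists x, p, (z + p - x).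
by rewrite mem_cat xt inE zD; split => //; rewrite addrCA subrr addr0.
Qed.

End Covering.
End Finite.

(** * Lebesgue measure of finite unions of boxes *)

Section Volume.
Variable R : realType.

(* No measurability is needed: the integral of a nonnegative function is the
   supremum of the integrals of the simple functions below it. *)
Lemma ge0_integral_mono d (T : measurableType d)
    (mu : {measure set T -> \bar R}) (f g : T -> \bar R) :
  (forall x, 0 <= f x)%E -> (forall x, f x <= g x)%E ->
  (\int[mu]_x f x <= \int[mu]_x g x)%E.
Proof.
move=> f0 fg; rewrite !ge0_integralTE//; last by move=> x; exact: le_trans (fg x).
by apply: le_ereal_sup; apply: image_subset => h hf x; exact: le_trans (fg x).
Qed.

Lemma tuple_lebesgue_ge0 m (A : set (m.-tuple (measurableTypeR R))) :
  (0 <= tuple_lebesgue A)%E.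
Proof.
elim: m A => [A|m IH A]; first exact: measure_ge0.
by apply: integral_ge0 => x _; exact: IH.
Qed.

(** Induction on the dimension. The section of A at first coordinate x is covered by the boxes whose
    first side contains x, so its measure is at most the step function [g], each term of which
    integrates to h^(m+1). *)
Lemma tuple_lebesgue_le_boxes m (h : R) (s : seq (m.-tuple R))
    (A : set (m.-tuple (measurableTypeR R))) : 0 <= h ->
  (forall t, A t -> exists2 c, c \in s &
     forall i, tnth c i <= (tnth t i : R) <= tnth c i + h) ->
  (tuple_lebesgue A <= ((size s)%:R * h ^+ m)%:E)%E.
Proof.
move=> h0; elim: m s A => [s A As|m IH s A As] /=.
  rewrite expr0 mulr1 diracE; case: (boolP (_ \in A)) => [|_]; rewrite lee_fin ?ler0n//.
  rewrite inE => /As[c cs _]; rewrite ler1n lt0n size_eq0.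
  by apply: contraTneq cs => ->.
rewrite /product_measure1.
pose I (c : m.+1.-tuple R) := `[thead c, thead c + h]%classic.
have Ih c : lebesgue_measure (I c) = h%:E.
  rewrite lebesgue_measure_itv /= lte_fin ltrDl -EFinB addrC addKr.
  case: ifPn => //; rewrite -leNgt => h0'; congr (_%:E).
  by apply/eqP; rewrite eq_le h0 h0'.
pose g (x : measurableTypeR R) : \bar R :=
  (\sum_(c <- s) (h ^+ m * \1_(I c) x)%:E)%E.
apply: (@le_trans _ _ (\int[@lebesgue_measure R]_x g x)%E).
  apply: ge0_integral_mono => [x|x /=]; first exact: tuple_lebesgue_ge0.
  pose s' := [seq [tuple of behead c] | c : m.+1.-tuple R <- s & x \in I c].
  apply: (le_trans (IH s' _ _)) => [t|].
    rewrite /xsection /= inE /= => /As[c cs ct].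
    exists [tuple of behead c] => [|i].
      apply/mapP; exists c => //; rewrite mem_filter cs andbT inE /I/= in_itv/=.
      exact: (ct ord0).
    have := ct (lift ord0 i).
    by rewrite !(tnth_nth 0) /= nth_behead.
  rewrite /g sumEFin lee_fin -mulr_sumr mulrC size_map size_filter.
  rewrite -sum1_count natr_sum big_mkcond /= ler_wpM2l ?exprn_ge0//.
  by apply: ler_sum => c _; rewrite indicE; case: (x \in I c).
rewrite ge0_integral_sum//=; last 2 first.
- move=> c; apply/measurable_EFinP; apply: measurable_funM => //.
  by apply: measurable_indic; exact: measurable_itv.
- by move=> c x _; rewrite lee_fin mulr_ge0 ?exprn_ge0.
apply: (@le_trans _ _ (\sum_(c <- s) (h ^+ m.+1)%:E)%E).
  apply: lee_sum => c _; under eq_integral do rewrite EFinM.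
  rewrite ge0_integralZl_EFin ?exprn_ge0//=; last first.
    by apply/measurable_EFinP; apply: measurable_indic; exact: measurable_itv.
  rewrite integral_indic//; last exact: measurable_itv.
  by rewrite setIT exprSr EFinM -(Ih c).
by rewrite sumEFin lee_fin big_const_seq count_predT iter_addr_0 mulr_natl.
Qed.
End Volume.

(** * Convex bodies and lattice points *)

Section Bodies.
Variables (R : realType) (n : nat).
Implicit Types (A B : set 'rV[R]_n) (x y w : 'rV[R]_n) (l m h s : R).

(* For l > 0 this is the dilate l A (for l = 0, the junk value 0^-1 = 0 makes
   it empty or everything). *)
Definition scale l A : set 'rV[R]_n := [set x | A (l^-1 *: x)].

Definition translate c A : set 'rV[R]_n := [set x | A (x - c)].

Definition segment_closed A :=
  forall x y t, A x -> A y -> 0 <= t <= 1 -> A (t *: x + (1 - t) *: y).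

(** The cube around 0 makes the dilates of A increase with their ratio and lets a small dilate of A
    contain any small box; boundedness keeps the lattice counts finite. *)
Definition body A := [/\ segment_closed A,
  exists2 r, 0 < r & @cube R n r `<=` A &
  exists b, A `<=` @cube R n b].

(* Half-open, so that the boxes at the points of h Z^n tile the space. *)
Definition box h w := forall i, 0 <= w ord0 i < h.

(** Rounding to the lattice h Z^n displaces a point by an element of a box; B is a slightly larger
    set than A that has room for this displacement. *)
Definition thickens h A B := forall x w, A x -> box h w -> B (x + w).

Lemma scale_scale l m A : scale l (scale m A) = scale (l * m) A.
Proof. by apply/funext => x; rewrite /scale /= scalerA invfM mulrC. Qed.

Lemma scale1 A : scale 1 A = A.
Proof. by apply/funext => x; rewrite /scale /= invr1 scale1r. Qed.

Lemma scale_cube l s : 0 < l -> scale l (@cube R n s) = cube (l * s).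
Proof.
move=> l0; apply/seteqP; split=> x xs i; have := xs i; rewrite mxE.
  by rewrite ler_pdivlMl// ler_pdivrMl// mulrN.
by rewrite ler_pdivlMl// ler_pdivrMl// mulrN.
Qed.

Lemma cube_sub s s' : s <= s' -> @cube R n s `<=` cube s'.
Proof.
move=> ss x xs i; have /andP[a b] := xs i.
by rewrite (le_trans b ss) andbT; apply: le_trans a; rewrite lerN2.
Qed.

Lemma translate_bounded c A : (exists b, A `<=` @cube R n b) ->
  exists b, translate c A `<=` @cube R n b.
Proof.
move=> [b Ab]; exists (b + \sum_i `|c ord0 i|) => x Ax i.
have ci : `|c ord0 i| <= \sum_i `|c ord0 i| by rewrite (bigD1 i)//= lerDl sumr_ge0.
have := Ab _ Ax i; have := ler_norm (c ord0 i); have := ler_norm (- c ord0 i).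
by rewrite normrN !mxE; move: ci; clear; lra.
Qed.

Lemma scaleS l A B : A `<=` B -> scale l A `<=` scale l B.
Proof. by move=> AB x; exact: AB. Qed.

Lemma body_scale l A : 0 < l -> body A -> body (scale l A).
Proof.
move=> l0 [cA [r r0 rA] [b bA]]; split.
- move=> x y t Ax Ay t01; rewrite /scale /= scalerDr !scalerA.
  by rewrite ![l^-1 * _]mulrC -!scalerA; exact: cA.
- exists (l * r); first exact: mulr_gt0.
  by rewrite -scale_cube//; exact: scaleS.
- by exists (l * b); rewrite -scale_cube//; exact: scaleS.
Qed.

Lemma body0 A : body A -> A 0.
Proof.
by move=> [_ [r r0 rA] _]; apply: rA => i; rewrite mxE oppr_le0 (ltW r0).
Qed.

Lemma scaleD l m A x y : body A -> 0 < l -> 0 < m ->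
  scale l A x -> scale m A y -> scale (l + m) A (x + y).
Proof.
move=> [cA _ _] l0 m0 lx my; rewrite /scale /=.
have lm : 0 < l + m by rewrite addr_gt0.
have -> : (l + m)^-1 *: (x + y) =
    (l / (l + m)) *: (l^-1 *: x) + (1 - l / (l + m)) *: (m^-1 *: y).
  rewrite scalerDr !scalerA; congr (_ *: _ + _ *: _); field;
  by rewrite ?lt0r_neq0.
apply: cA => //; apply/andP; split; first by rewrite divr_ge0 ?ltW.
by rewrite ler_pdivrMr// mul1r lerDl ltW.
Qed.

Lemma scale_sub l m A : body A -> 0 < l -> l <= m -> scale l A `<=` scale m A.
Proof.
move=> bA l0; rewrite le_eqVlt => /predU1P[->//|lm] x lx.
rewrite -(addr0 x) -(subrK l m) addrC; apply: scaleD; rewrite ?subr_gt0//.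
by rewrite /scale /= scaler0; exact: body0.
Qed.

Lemma box_cube h w : box h w -> @cube R n h w.
Proof.
move=> hw i; have /andP[w0 wh] := hw i.
by apply/andP; split; lra.
Qed.

(** A box of side h <= d r lies in the cube of radius d r, hence in d A, and A + d A is contained in
    (1 + d) A by convexity. *)
Lemma body_thickens A r d h : body A -> cube r `<=` A -> 0 < d -> h <= d * r ->
  thickens h A (scale (1 + d) A).
Proof.
move=> bA rA d0 hd x w Ax /box_cube hw; apply: scaleD => //.
  by rewrite /scale /= invr1 scale1r.
by apply: (scaleS rA); rewrite scale_cube//; exact: cube_sub hw.
Qed.

Definition difference_body A : set 'rV[R]_n :=
  [set z | exists x y, [/\ A x, A y & z = x - y]].

Lemma body_difference A : body A -> body (difference_body A).
Proof.
move=> bA; have A0 := body0 bA; have [cA [r r0 rA] [b bA']] := bA; split.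
- move=> _ _ t [x [y [Ax Ay ->]]] [x' [y' [Ax' Ay' ->]]] t01.
  exists (t *: x + (1 - t) *: x'), (t *: y + (1 - t) *: y'); split.
  + exact: cA.
  + exact: cA.
  + by rewrite !scalerBr opprD addrACA.
- by exists r => // x xr; exists x, 0; rewrite subr0; split=> //; exact: rA.
- exists (b + b) => _ [x [y [Ax Ay ->]]] i; rewrite !mxE.
  have /andP[x1 x2] := bA' _ Ax i; have /andP[y1 y2] := bA' _ Ay i.
  by rewrite opprD !lerD// ?lerN2// lerNl.
Qed.

End Bodies.

(** * Counting points of the lattice h Z^n *)

Section LatticeCount.
Variables (R : realType) (n : nat).
Implicit Types (A B : set 'rV[R]_n) (x y w c : 'rV[R]_n) (z : 'rV[int]_n).
Implicit Types (h s : R).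

Definition lattice_point h z : 'rV[R]_n := h *: map_mx intr z.

Lemma lattice_pointE h z i : lattice_point h z ord0 i = h * (z ord0 i)%:~R.
Proof. by rewrite !mxE. Qed.

Lemma lattice_pointD h z z' :
  lattice_point h (z + z') = lattice_point h z + lattice_point h z'.
Proof. by rewrite /lattice_point map_mxD scalerDr. Qed.

Lemma lattice_pointN h z : lattice_point h (- z) = - lattice_point h z.
Proof. by rewrite /lattice_point map_mxN scalerN. Qed.

Lemma lattice_pointB h z z' :
  lattice_point h (z - z') = lattice_point h z - lattice_point h z'.
Proof. by rewrite lattice_pointD lattice_pointN. Qed.

Lemma lattice_floor h c : 0 < h -> exists z, box h (c - lattice_point h z).
Proof.
move=> h0; exists (\row_i Num.floor (c ord0 i / h)) => i.
have /andP[] := floor_itv (c ord0 i / h); rewrite intrD1 !mxE.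
rewrite ler_pdivlMr// ltr_pdivrMr// mulrDl mul1r => ? ?.
by apply/andP; split; lra.
Qed.

Lemma lattice_ceil h c : 0 < h -> exists z, box h (lattice_point h z - c).
Proof.
move=> h0; have [z hz] := lattice_floor (- c) h0.
by exists (- z); rewrite lattice_pointN addrC.
Qed.

Definition int_box (a : 'rV[int]_n) k : {fset 'rV[int]_n} :=
  [fset (a + map_mx (fun i : 'I_k => i%:Z) w)%R | w in {: 'rV['I_k]_n}]%fset.

Lemma mem_int_box a k z : (z \in int_box a k) =
  [forall i, a ord0 i <= z ord0 i < a ord0 i + k%:Z].
Proof.
apply/imfsetP/forallP => [[w /= _ -> i]|zk].
  by rewrite !mxE lerDl ltrD2l ltz_nat ltn_ord andbT.
have H i : (`|z ord0 i - a ord0 i| < k)%N.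
  by have := zk i; lia.
exists (\row_i Ordinal (H i)) => //; apply/rowP => i; rewrite !mxE /=.
by have /andP[az _] := zk i; rewrite gez0_abs ?subr_ge0// addrC subrK.
Qed.

Lemma card_int_box a k : #|` int_box a k| = (k ^ n)%N.
Proof.
rewrite card_imfset /= -?cardT ?card_mx ?card_ord ?mul1n// => u v /addrI e.
apply/rowP => i; have /rowP/(_ i) := e; rewrite !mxE => -[?].
exact: val_inj.
Qed.

(** [fset_set] returns the empty set on infinite sets, so membership is meaningful only for bounded
    A and h > 0; hence the boundedness hypotheses on the counts below. *)
Definition lattice_points h A : {fset 'rV[int]_n} :=
  fset_set [set z | A (lattice_point h z)].

Definition lattice_count h A := #|` lattice_points h A|.

Lemma lattice_bounds h z (a b : R) i : 0 < h ->
  a <= lattice_point h z ord0 i <= b ->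
  0 <= z ord0 i - Num.ceil (a / h) < (Num.truncn ((b - a) / h)).+1%:Z.
Proof.
move=> h0; rewrite lattice_pointE => /andP[az zb].
have ca : Num.ceil (a / h) <= z ord0 i by rewrite ceil_le_int ler_pdivrMr// mulrC.
rewrite subr_ge0 ca /=.
have [k kE] : exists k : nat, z ord0 i - Num.ceil (a / h) = k%:Z.
  by exists `|z ord0 i - Num.ceil (a / h)|%N; rewrite gez0_abs// subr_ge0.
rewrite kE ltz_nat ltnS truncn_ge_nat; last first.
  by rewrite divr_ge0 ?subr_ge0 ?(le_trans az)// ltW.
have -> : k%:R = (z ord0 i)%:~R - (Num.ceil (a / h))%:~R :> R by rewrite -intrB kE.
by rewrite mulrBl lerB ?ceil_ge// ler_pdivlMr// mulrC.
Qed.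

Lemma mem_lattice_points h A z : 0 < h -> (exists b, A `<=` @cube R n b) ->
  z \in lattice_points h A <-> A (lattice_point h z).
Proof.
move=> h0 [b Ab]; rewrite in_fset_set; first by split; rewrite inE.
apply: (@sub_finite_set _ _ [set` int_box (const_mx (Num.ceil (- b / h)))
    (Num.truncn ((b - - b) / h)).+1]); last exact: finite_fset.
move=> y Ay /=; rewrite mem_int_box; apply/forallP => i; rewrite mxE.
by rewrite -subr_ge0 -ltrBlDl; exact: lattice_bounds h0 (Ab _ Ay i).
Qed.

Lemma lattice_count_le h A c s : 0 < h -> 0 <= s ->
  (forall x, A x -> forall i, c ord0 i <= x ord0 i <= c ord0 i + s) ->
  (lattice_count h A)%:R <= (s / h + 1) ^+ n :> R.
Proof.
move=> h0 s0 As.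
have Ab : exists b, A `<=` @cube R n b.
  exists (\sum_i `|c ord0 i| + s) => x Ax i.
  have ci : `|c ord0 i| <= \sum_i `|c ord0 i| by rewrite (bigD1 i)//= lerDl sumr_ge0.
  have := As x Ax i; have := ler_norm (c ord0 i); have := ler_norm (- c ord0 i).
  by rewrite normrN; lra.
apply: (@le_trans _ _ ((Num.truncn (s / h)).+1 ^ n)%:R).
  rewrite ler_nat -(card_int_box (\row_i Num.ceil (c ord0 i / h))).
  apply/fsubset_leq_card/fsubsetP => z /(mem_lattice_points _ h0 Ab) /As Az.
  rewrite mem_int_box; apply/forallP => i; rewrite mxE.
  by have := lattice_bounds h0 (Az i); rewrite [_ + s]addrC addrK subr_ge0 ltrBlDl.
have sh : 0 <= s / h := divr_ge0 s0 (ltW h0).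
rewrite natrX; apply: lerXn2r; rewrite ?nnegrE ?ler0n ?addr_ge0//.
by rewrite -natr1 lerD2r truncn_le.
Qed.

Lemma lattice_count_ge h A c s : 0 < h -> 0 <= s ->
  (exists b, A `<=` @cube R n b) ->
  (forall x, (forall i, c ord0 i <= x ord0 i < c ord0 i + s) -> A x) ->
  (Num.truncn (s / h) ^ n <= lattice_count h A)%N.
Proof.
move=> h0 s0 Ab As; rewrite -(card_int_box (\row_i Num.ceil (c ord0 i / h))).
apply/fsubset_leq_card/fsubsetP => z; rewrite mem_int_box => /forallP zk.
apply/(mem_lattice_points _ h0 Ab)/As => i; rewrite lattice_pointE.
have := zk i; rewrite mxE => /andP[cz zc].
rewrite -ler_pdivrMl// mulrC -ceil_le_int cz /=.
have k1 : (Num.truncn (s / h))%:R <= s / h by rewrite truncn_le// divr_ge0// ltW.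
have := ceilB1_lt (c ord0 i / h); rewrite intrB => c1.
have : (z ord0 i + 1)%:~R <= (Num.ceil (c ord0 i / h) + (Num.truncn (s / h))%:Z)%:~R :> R.
  by rewrite ler_int lezD1.
rewrite !intrD /= -pmulrn => zc'.
have : (z ord0 i)%:~R < (c ord0 i + s) / h by rewrite mulrDl; lra.
by rewrite ltr_pdivlMr// mulrC.
Qed.
End LatticeCount.

(** * Jordan content of convex bodies *)

Section Content.
Variables (R : realType) (n : nat).
Implicit Types (A B : set 'rV[R]_n) (x w c : 'rV[R]_n) (y z : 'rV[int]_n).
Implicit Types (h u d v : R).

(** The vector c is rounded down to a lattice vector, and translation by a lattice vector preserves
    counts; the remainder of c lies in a box, which B absorbs. *)
Lemma lattice_count_shift_le h A B c : 0 < h ->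
  (exists b, A `<=` @cube R n b) -> (exists b, B `<=` @cube R n b) ->
  thickens h A B -> (lattice_count h (translate c A) <= lattice_count h B)%N.
Proof.
move=> h0 Ab Bb AB; have [z0 z0c] := lattice_floor c h0.
have sb : exists b, translate c A `<=` @cube R n b := translate_bounded c Ab.
apply: (@card_le_inj _ _ _ _ (fun z => z - z0)) => [z z' _ _ /addIr//|z].
move=> /(mem_lattice_points _ h0 sb) Az; apply/(mem_lattice_points _ h0 Bb).
rewrite lattice_pointB -(subrK c (lattice_point h z)) -addrA.
exact: AB.
Qed.

Lemma lattice_count_shift_ge h A B c : 0 < h ->
  (exists b, A `<=` @cube R n b) -> (exists b, B `<=` @cube R n b) ->
  thickens h A B -> (lattice_count h A <= lattice_count h (translate c B))%N.
Proof.
move=> h0 Ab Bb AB; have [z0 z0c] := lattice_ceil c h0.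
have sb : exists b, translate c B `<=` @cube R n b := translate_bounded c Bb.
apply: (@card_le_inj _ _ _ _ (fun z => z + z0)) => [z z' _ _ /addIr//|z].
move=> /(mem_lattice_points _ h0 Ab) Az; apply/(mem_lattice_points _ h0 sb).
rewrite /translate /= lattice_pointD -addrA.
exact: AB.
Qed.

Lemma lattice_count_sub h A B : 0 < h -> (exists b, B `<=` @cube R n b) ->
  A `<=` B -> (lattice_count h A <= lattice_count h B)%N.
Proof.
move=> h0 Bb AB; have Ab : exists b, A `<=` @cube R n b.
  by have [b bB] := Bb; exists b; exact: subset_trans bB.
apply/fsubset_leq_card/fsubsetP => z /(mem_lattice_points _ h0 Ab) Az.
exact/(mem_lattice_points _ h0 Bb)/AB.
Qed.

Lemma lattice_count_opp h A : 0 < h -> (exists b, A `<=` @cube R n b) ->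
  (lattice_count h A <= lattice_count h [set x | A (- x)])%N.
Proof.
move=> h0 Ab; have Ab' : exists b, [set x | A (- x)] `<=` @cube R n b.
  have [b bA] := Ab; exists b => x /bA xb i; have := xb i.
  by rewrite mxE lerN2 lerNl andbC.
apply: (@card_le_inj _ _ _ _ -%R) => [z z' _ _ /oppr_inj//|z].
move=> /(mem_lattice_points _ h0 Ab) Az; apply/(mem_lattice_points _ h0 Ab').
by rewrite /= lattice_pointN opprK.
Qed.

Lemma lattice_count_scale h l A : lattice_count h (scale l A) = lattice_count (h / l) A.
Proof.
congr (#|` fset_set _|); apply/funext => z /=.
by rewrite /scale /= /lattice_point scalerA mulrC.
Qed.

(** The boxes of side h at the points of h Z^n in A are disjoint and contained in B, and each
    contains at least floor(h/u)^n points of u Z^n. *)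
Lemma refine_count h u A B : 0 < h -> 0 < u ->
  (exists b, A `<=` @cube R n b) -> (exists b, B `<=` @cube R n b) ->
  thickens h A B ->
  (Num.truncn (h / u) ^ n * lattice_count h A <= lattice_count u B)%N.
Proof.
move=> h0 u0 Ab Bb AB.
pose inbox (y z : 'rV[int]_n) := `[< box h (lattice_point u y - lattice_point h z) >].
have S1 : (\sum_(z <- lattice_points h A)
   #|` [fset y in lattice_points u B | inbox y z]%fset| <= lattice_count u B)%N.
  rewrite (@sum_card_exchange _ _ _ _ (fun z y => inbox y z)).
  rewrite -[leqRHS]muln1; apply: sum_fset_le => y _.
  apply: (@leq_trans #|` [fset (0 : 'rV[int]_n)]%fset|); last by rewrite cardfs1.
  apply: (@card_le_inj _ _ _ _ (fun=> 0)) => [z z'|z _]; last by rewrite inE.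
  rewrite !inE => /andP[_ /asboolP yz] /andP[_ /asboolP yz'] _.
  apply/rowP => i; have := yz i; have := yz' i; rewrite mxE [in X in _ -> X -> _]mxE.
  rewrite !mxE.
  move: (u * _) (z ord0 i) (z' ord0 i) => a p q hq hp.
  have : h * p%:~R < h * (q + 1)%:~R by rewrite intrD1 mulrDr; lra.
  have : h * q%:~R < h * (p + 1)%:~R by rewrite intrD1 mulrDr; lra.
  by rewrite !ltr_pM2l// !ltr_int; lia.
apply: leq_trans S1; rewrite mulnC; apply: sum_fset_ge => z.
move=> /(mem_lattice_points _ h0 Ab) Az.
set S := [fset y in _ | _]%fset.
pose C := [set x | box h (x - lattice_point h z)].
have CB : C `<=` B by move=> x /(AB _ _ Az); rewrite addrC subrK.
have Cb : exists b, C `<=` @cube R n b.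
  by have [b bB] := Bb; exists b; exact: subset_trans bB.
have -> : S = lattice_points u C.
  apply/fsetP => y; apply/idP/idP.
    rewrite !inE => /andP[_ /asboolP yz]; exact/(mem_lattice_points _ u0 Cb).
  move=> /(mem_lattice_points _ u0 Cb) Cy; rewrite !inE; apply/andP; split.
    exact/(mem_lattice_points _ u0 Bb)/CB.
  exact/asboolP.
apply: (lattice_count_ge (c := lattice_point h z)) => // [|x xh i]; first exact: ltW.
by rewrite !mxE; have := xh i; rewrite !mxE; lra.
Qed.

Lemma exp_small k d : 0 < d -> exists2 e, 0 < e & (1 + e) ^+ k <= 1 + d :> R.
Proof.
move=> d0; have p3 j : 0 < 3 ^+ j :> R by rewrite exprn_gt0.
(* For e <= 1, (1 + 3^j e)(1 + e) <= 1 + 3^(j+1) e, so (1 + e)^k is at most 1 + 3^k e by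
   induction. *)
pose e := Num.min 1 (d / 3 ^+ k).
have e0 : 0 < e by rewrite lt_min ltr01 divr_gt0.
have e1 : e <= 1 by rewrite ge_min lexx.
exists e => //; suff H j : (1 + e) ^+ j <= 1 + 3 ^+ j * e.
  apply: le_trans (H k) _; rewrite lerD2l mulrC -ler_pdivlMr//.
  by rewrite ge_min lexx orbT.
elim: j => [|j IH]; first by rewrite !expr0 mul1r lerDl ltW.
rewrite exprSr; apply: (@le_trans _ _ ((1 + 3 ^+ j * e) * (1 + e))).
  by rewrite ler_pM2r// addr_gt0.
have j1 : 1 <= 3 ^+ j :> R by rewrite exprn_ege1// ler1n.
have : e * 1 <= e * 3 ^+ j by rewrite ler_pM2l.
have : 3 ^+ j * e * e <= 3 ^+ j * e * 1 by rewrite ler_pM2l// mulr_gt0.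
by rewrite exprSr; lra.
Qed.

(** Removes the discretization errors: each estimate is proved up to a power of 1 + d whose exponent
    k is independent of d. *)
Lemma ler_mul1Dexp k (a b : R) : 0 <= b ->
  (forall d, 0 < d -> a <= b * (1 + d) ^+ k) -> a <= b.
Proof.
move=> b0 H; apply/ler_addgt0Pr => e e0.
have b1 : 0 < b + 1 by rewrite ltr_wpDl.
have [d d0 dk] := exp_small k (divr_gt0 e0 b1).
apply: le_trans (H d d0) _; apply: le_trans (ler_wpM2l b0 dk) _.
by rewrite mulrDr mulr1 lerD2l mulrCA ler_piMr ?(ltW e0)// ler_pdivrMr// mul1r lerDl.
Qed.

(* v is the Jordan content of A, stated with a relative error. *)
Definition has_content A v := 0 < v /\ forall d, 0 < d ->
  exists2 h0, 0 < h0 & forall h, 0 < h -> h < h0 ->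
    v <= (1 + d) * (h ^+ n * (lattice_count h A)%:R) /\
    h ^+ n * (lattice_count h A)%:R <= (1 + d) * v.

Lemma has_content_scale A v l : 0 < l -> has_content A v -> has_content (scale l A) (l ^+ n * v).
Proof.
move=> l0 [v0 Av]; split=> [|d d0]; first by rewrite mulr_gt0 ?exprn_gt0.
have [h0 h00 H] := Av d d0; exists (l * h0) => [|h hp hl]; first exact: mulr_gt0.
have [|//|H1 H2] := H (h / l); first exact: divr_gt0.
  by rewrite ltr_pdivrMr// mulrC.
rewrite lattice_count_scale.
have hE : h ^+ n = l ^+ n * (h / l) ^+ n by rewrite -exprMn mulrC divfK ?gt_eqF.
by rewrite hE -!mulrA !(mulrCA (1 + d) (l ^+ n)) !ler_pM2l ?exprn_gt0//.
Qed.

(* refine_count shows that (h / (1 + h / r))^n * lattice_count h A is at most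
   the limit for every h > 0, so the content is the supremum of these values. *)
Lemma body_content A : body A -> exists v, has_content A v.
Proof.
move=> bA; have A0 := body0 bA; have [_ [r r0 rA] [b Ab]] := bA.
have Ab' : exists b, A `<=` @cube R n b by exists b.
pose t h := h / (1 + h / r).
have hr h : 0 < h -> 0 < 1 + h / r by move=> h0; rewrite addr_gt0 ?divr_gt0.
have t0 h : 0 < h -> 0 < t h by move=> h0; rewrite divr_gt0 ?hr.
pose S := [set t h ^+ n * (lattice_count h A)%:R | h in [set h | 0 < h]].

(* The bound is uniform in h because the product of t h with 2 |b| / h + 1 is (2 |b| + h) / (1 + h /
   r), and h = r (h / r). *)
have Sub : ubound S ((2 * `|b| + r) ^+ n).
  move=> _ [h h0 <-].
  apply: (@le_trans _ _ (t h ^+ n * (2 * `|b| / h + 1) ^+ n)).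
    rewrite ler_pM2l ?exprn_gt0 ?t0//.
    apply: (@lattice_count_le R n h A (const_mx (- `|b|)) (2 * `|b|) h0) => [|x /Ab xb i].
      by rewrite mulr_ge0.
    by have := xb i; have := ler_norm b; rewrite mxE; lra.
  rewrite -exprMn; apply: lerXn2r.
  - rewrite nnegrE; apply: mulr_ge0; first exact: ltW (t0 _ h0).
    by apply: addr_ge0 => //; apply: divr_ge0 (ltW h0); rewrite mulr_ge0.
  - by rewrite nnegrE addr_ge0 ?mulr_ge0 ?(ltW r0).
  have := h0; rewrite /= => h0'.
  have -> : t h * (2 * `|b| / h + 1) = (2 * `|b| + h) / (1 + h / r).
    by rewrite /t; field; rewrite !gt_eqF ?hr ?addr_gt0.
  rewrite ler_pdivrMr ?hr//.
  have rq : r * (h / r) = h by rewrite mulrC divfK ?gt_eqF.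
  have bq : 0 <= `|b| * (h / r) by apply: mulr_ge0 => //; exact: divr_ge0 (ltW h0) (ltW r0).
  by move: rq bq; set q := h / r; lra.
have SE h : 0 < h -> S (t h ^+ n * (lattice_count h A)%:R) by move=> ?; exists h.
have c0 h : 0 < h -> 0 < (lattice_count h A)%:R :> R.
  move=> h0; rewrite ltr0n cardfs_gt0; apply/fset0Pn; exists 0.
  by apply/(mem_lattice_points _ h0 Ab'); rewrite /lattice_point map_mx0 scaler0.
have hS : has_sup S by split; [eexists; exact: (SE 1)|eexists; exact: Sub].
pose v := sup S.
have vS h : 0 < h -> t h ^+ n * (lattice_count h A)%:R <= v.
  by move=> h0; apply: ub_le_sup; [exact: hS.2|exact: SE].
have v0 : 0 < v.
  apply: lt_le_trans (vS 1 _) => //; rewrite mulr_gt0 ?c0// exprn_gt0//.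
  exact: t0.
exists v; split=> // d d0.
have [e e0 ed] := exp_small n.+1 d0.
have [_ [h /= h0 <-] hv] : exists2 x, S x & v / (1 + e) < x.
  apply: sup_gt => //; first by case: hS.
  by rewrite ltr_pdivrMr ?addr_gt0// ltr_pMr// ltrDl.
(* [refine_count] is used with the meshes h and u (1 + h / r). Rescaling by 1 + h / r turns the
   finer count into [lattice_count u A], and taking the floor loses at most u, which is small
   compared with t h. *)
have step u : 0 < u -> u <= t h * e / (1 + e) ->
    v <= (1 + d) * (u ^+ n * (lattice_count u A)%:R).
  move=> u0 ut.
  have lr : 0 < 1 + h / r := hr _ h0.
  have th : thickens h A (scale (1 + h / r) A).
    by apply: (body_thickens bA rA); rewrite ?divr_gt0// divfK ?gt_eqF.
  have [_ _ Bb] := body_scale lr bA.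
  have := refine_count h0 (mulr_gt0 u0 lr) Ab' Bb th.
  rewrite lattice_count_scale mulfK ?gt_eqF//.
  rewrite -(ler_nat R) natrM natrX => le1.
  set k : R := (Num.truncn _)%:R in le1.
  have e1 : 0 < 1 + e by rewrite addr_gt0.
  have uk : t h <= (1 + e) * (u * k).
    have k1 : h / (u * (1 + h / r)) < k + 1 by rewrite natr1 truncnS_gt.
    have : u * (h / (u * (1 + h / r))) < u * (k + 1) by rewrite ltr_pM2l.
    have -> : u * (h / (u * (1 + h / r))) = t h.
      by rewrite /t invfM mulrCA [u * (_ / _)]mulrA mulfV ?gt_eqF// mul1r.
    move: ut; rewrite ler_pdivlMr// => ut tu.
    have : (1 + e) * t h <= (1 + e) * (u * (k + 1)) by rewrite ler_pM2l// ltW.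
    by rewrite mulrDr mulr1 mulrDr; lra.
  have vl : v <= t h ^+ n * (lattice_count h A)%:R * (1 + e).
    by rewrite -ler_pdivrMr// ltW.
  apply: le_trans vl _.
  apply: (@le_trans _ _ (((1 + e) * (u * k)) ^+ n * (lattice_count h A)%:R * (1 + e))).
    rewrite ler_pM2r// ler_pM2r ?c0//; apply: lerXn2r => //; rewrite nnegrE.
      exact: ltW (t0 _ h0).
    exact: mulr_ge0 (ltW e1) (mulr_ge0 (ltW u0) (ler0n _ _)).
  apply: (@le_trans _ _ ((1 + e) ^+ n.+1 * (u ^+ n * (lattice_count u A)%:R))).
    have -> : ((1 + e) * (u * k)) ^+ n * (lattice_count h A)%:R * (1 + e)
        = (1 + e) ^+ n.+1 * (u ^+ n * (k ^+ n * (lattice_count h A)%:R)).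
      by rewrite !exprMn exprS; ring.
    by rewrite !ler_pM2l ?exprn_gt0.
  by rewrite ler_pM2r// mulr_gt0 ?c0// exprn_gt0.
have te : 0 < t h * e / (1 + e).
  exact: divr_gt0 (mulr_gt0 (t0 _ h0) e0) (addr_gt0 ltr01 e0).
(* The first bound serves the lower estimate through [step]; the second, u <= e r, keeps the factor
   (1 + u / r)^n between u^n and (t u)^n below (1 + e)^n. *)
exists (Num.min (t h * e / (1 + e)) (e * r)) => [|u u0].
  by rewrite lt_min te mulr_gt0.
rewrite lt_min => /andP[u1 u2]; split; first exact: step (ltW u1).
have ur := hr u u0.
have -> : u ^+ n = (1 + u / r) ^+ n * t u ^+ n.
  by rewrite -exprMn /t mulrC divfK ?gt_eqF.
rewrite -mulrA; apply: (@le_trans _ _ ((1 + u / r) ^+ n * v)).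
  by rewrite ler_pM2l ?exprn_gt0 ?vS.
rewrite ler_pM2r//; apply: le_trans ed.
apply: (@le_trans _ _ ((1 + e) ^+ n)).
  apply: lerXn2r.
  - by rewrite nnegrE (ltW ur).
  - by rewrite nnegrE (ltW (addr_gt0 ltr01 e0)).
  - by rewrite lerD2l ler_pdivrMr// (ltW u2).
by rewrite exprS ler_pMl ?exprn_gt0 ?addr_gt0// lerDl ltW.
Qed.
End Content.

(** * Rogers' covering bound *)

Section Rogers.
Variables (R : realType) (n : nat).
Implicit Types (A B : set 'rV[R]_n) (x w c : 'rV[R]_n) (y z : 'rV[int]_n).

Lemma lattice_count_cube_le h s : 0 < h -> 0 <= s ->
  h ^+ n * (lattice_count h (@cube R n s))%:R <= (2 * s + h) ^+ n.
Proof.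
move=> h0 s0.
apply: (@le_trans _ _ (h ^+ n * (2 * s / h + 1) ^+ n)).
  rewrite ler_pM2l ?exprn_gt0//.
  apply: (@lattice_count_le R n h _ (const_mx (- s)) (2 * s) h0) => [|x xs i].
    by rewrite mulr_ge0.
  by have := xs i; rewrite mxE; lra.
by rewrite -exprMn mulrDr mulr1 [h * _]mulrC divfK ?gt_eqF.
Qed.

Lemma exp_1B_le (x L : R) N : x <= 1 -> L <= N%:R * x -> (1 - x) ^+ N <= expR (- L).
Proof.
move=> x1 LN; apply: (@le_trans _ _ (expR (- x) ^+ N)).
  by apply: lerXn2r; rewrite ?nnegrE ?subr_ge0 ?expR_ge0// expR_ge1Dx.
by rewrite -expRM_natl ler_expR mulrN lerN2.
Qed.

Lemma sum_cube a b x w : @cube R n a x -> @cube R n b w -> cube (a + b) (x + w).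
Proof.
move=> xa wb i; have /andP[x1 x2] := xa i; have /andP[w1 w2] := wb i.
by rewrite mxE; apply/andP; split; lra.
Qed.

Lemma opp_cube a x : @cube R n a x -> cube a (- x).
Proof. by move=> xa i; have := xa i; rewrite mxE; lra. Qed.

Lemma cube_bounded s : exists b, @cube R n s `<=` @cube R n b.
Proof. by exists s. Qed.

(* A greedy choice of N translates of the lattice points of A' leaves at most a
   proportion eta^n of the cube uncovered; the rest is packed by translates of
   - eta A', and both families, enlarged by eta A', cover. *)
Lemma lattice_rogers_cover A' h eta b s : body A' -> 0 < h -> 0 < eta < 1 ->
  (forall x, A' x -> A' (- eta *: x)) -> 0 <= b -> A' `<=` cube b -> 0 <= s ->
  let q := (lattice_count h (@cube R n (s + h + b + b)))%:R in
  let L := - (n%:R * ln eta) in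
  exists t : seq 'rV[int]_n,
    (size t)%:R <= 1 + L * (q / (lattice_count h A')%:R)
                   + eta ^+ n * (q / (lattice_count (h / eta) A')%:R) /\
    forall x, cube s x -> exists2 y, y \in t &
      exists2 u, scale (1 + eta) A' u & box h (x - lattice_point h y - u).
Proof.
move=> bA h0 /andP[eta0 eta1] Aeta b0 Ab s0 q L.
have A0 := body0 bA; have Ab' : exists b, A' `<=` @cube R n b by exists b.
pose A2 := scale eta [set x | A' (- x)].
have A2P x : A2 x -> scale eta A' (- x) by rewrite /A2 /scale /= scalerN.
have A2b x : A2 x -> cube b x.
  move=> /A2P Ax; rewrite -(opprK x); apply: opp_cube.
  by apply: Ab; rewrite -(scale1 A'); apply: (scale_sub bA eta0 (ltW eta1)).
have A2b' : exists b, A2 `<=` @cube R n b by exists b.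
have A2A x : A2 x -> A' x.
  move=> /Aeta; rewrite scalerN scaleNr opprK scalerA mulfV ?gt_eqF//.
  by rewrite scale1r.
pose D := lattice_points h A'; pose P := lattice_points h A2.
(* The radius grows by h for rounding x to a lattice point z, by b to contain z + P, and in Q' by b
   again for differences with D. *)
pose Q := lattice_points h (@cube R n (s + h + b)).
pose Q' := lattice_points h (@cube R n (s + h + b + b)).
have QP a z : z \in lattice_points h (@cube R n a) <-> cube a (lattice_point h z).
  exact: mem_lattice_points h0 (cube_bounded a).
have DP z : z \in D <-> A' (lattice_point h z) := mem_lattice_points _ h0 Ab'.
have PP z : z \in P <-> A2 (lattice_point h z) := mem_lattice_points _ h0 A2b'.
have QD : {in Q & D, forall q d, q - d \in Q'}.
  move=> z d /QP zQ /DP dD; apply/QP; rewrite lattice_pointB.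
  by apply: sum_cube zQ _; apply: opp_cube; exact: Ab.
have lp0 : lattice_point h 0 = 0 :> 'rV[R]_n by rewrite /lattice_point map_mx0 scaler0.
have c0 a : 0 <= a -> @cube R n a 0 by move=> a0 i; rewrite mxE oppr_le0 a0.
have P0 : P != fset0.
  by apply/fset0Pn; exists 0; apply/PP; rewrite lp0 /A2 /scale /= scaler0 oppr0.
have Q'0 : Q' != fset0.
  by apply/fset0Pn; exists 0; apply/QP; rewrite lp0; apply: c0; rewrite !addr_ge0// ltW.
pose dd : R := #|` D|%:R.
have dd0 : 0 < dd.
  by rewrite ltr0n cardfs_gt0; apply/fset0Pn; exists 0; apply/DP; rewrite lp0.
have q0 : 0 < q by rewrite ltr0n cardfs_gt0.
have L0 : 0 <= L by rewrite oppr_ge0 mulr_ge0_le0// ln_le0// ltW.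
(* With N dd / q >= L = - n ln eta, (1 - dd / q)^N <= exp(- L) = eta^n. The successor costs the
   leading 1 in the bound on [size t]. *)
pose N := (Num.truncn (L * (q / dd))).+1.
have [t [tN tc]] := greedy_packing_cover R N QD P0 Q'0.
have aL0 : 0 <= L * (q / dd) by rewrite mulr_ge0// divr_ge0// ltW.
exists t; split.
  apply: le_trans tN _; apply: lerD.
    by rewrite -natr1 addrC lerD2l truncn_le.
  have pp0 : 0 < #|` P|%:R :> R by rewrite ltr0n cardfs_gt0.
  have c1 : (lattice_count (h / eta) A')%:R <= #|` P|%:R :> R.
    rewrite ler_nat -/(lattice_count h A2) /A2 lattice_count_scale.
    by apply: lattice_count_opp => //; rewrite divr_gt0.
  have cp : 0 < (lattice_count (h / eta) A')%:R :> R.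
    rewrite ltr0n cardfs_gt0; apply/fset0Pn; exists 0.
    apply/(mem_lattice_points _ _ Ab'); rewrite ?divr_gt0//.
    by rewrite /lattice_point map_mx0 scaler0.
  have Qq : #|` Q|%:R <= q.
    rewrite ler_nat; apply: lattice_count_sub => //; first exact: cube_bounded.
    by apply: cube_sub; rewrite lerDl.
  have ddq : dd <= q.
    rewrite ler_nat; apply: lattice_count_sub => //; first exact: cube_bounded.
    by apply: (subset_trans Ab); apply: cube_sub; rewrite lerDr !addr_ge0// ltW.
  have e1 : (1 - dd / q) ^+ N <= eta ^+ n.
    have -> : eta ^+ n = expR (- L).
      by rewrite opprK expRM_natl lnK// posrE.
    apply: exp_1B_le; first by rewrite ler_pdivrMr// mul1r.
    rewrite mulrA ler_pdivlMr// -ler_pdivrMr//-mulrA.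
    by rewrite ltW// truncnS_gt.
  rewrite mulrA; apply: ler_pM.
  - by rewrite mulr_ge0// exprn_ge0// subr_ge0 ler_pdivrMr// mul1r.
  - by rewrite invr_ge0.
  - apply: ler_pM => //; rewrite exprn_ge0// subr_ge0 ler_pdivrMr// mul1r//.
  - by rewrite lef_pV2.
move=> x xs; have [z zx] := lattice_floor x h0.
have zs : cube (s + h) (lattice_point h z).
  have -> : lattice_point h z = x + - (x - lattice_point h z).
    by rewrite opprB addrC subrK.
  by apply: sum_cube xs _; apply: opp_cube; exact: box_cube.
have [p pP|y [p [d [yt /PP pP dDP e]]]] := tc z.
  by apply/QP; rewrite lattice_pointD; apply: sum_cube zs (A2b _ _); exact/PP.
(* From z + p = y + d one gets z - y = d - p, where d is in A' (which contains - eta A') and - p is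
   in eta A'; the sum is in (1 + eta) A'. *)
exists y => //; exists (lattice_point h d - lattice_point h p).
  apply: scaleD; rewrite ?scale1//; last exact: A2P.
  by move: dDP; rewrite inE => /orP[/DP//|/PP/A2A].
have -> : x - lattice_point h y - (lattice_point h d - lattice_point h p)
    = x - lattice_point h z.
  rewrite -addrA -opprD addrA -lattice_pointD -e lattice_pointD.
  by rewrite addrK.
by [].
Qed.
End Rogers.

Section RogersCover.
Variables (R : realType) (n : nat).
Implicit Types (A B : set 'rV[R]_n) (x w c : 'rV[R]_n) (y z : 'rV[int]_n).

Lemma covered_by_seq A B (t : seq 'rV[R]_n) :
  (forall x, A x -> exists2 y, y \in t & B (x - y)) -> covered_by_translates A B (size t).
Proof.
move=> AB; exists (fun i => t`_i) => x /AB[y yt Bxy].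
have it : (index y t < size t)%N by rewrite index_mem.
exists (Ordinal it) => //=; exists (x - y) => //.
by rewrite nth_index// addrC subrK.
Qed.

(** The lattice construction is run on A divided by (1 + eta)(1 + d): the first factor is restored
    by the enlargement, the second by the rounding to the lattice. Boundary effects vanish for large
    s. *)
Lemma rogers_cover A v eta d : (0 < n)%N -> body A -> has_content A v ->
  0 < eta < 1 -> (forall x, A x -> A (- eta *: x)) -> 0 < d ->
  exists2 s0, 0 < s0 & forall s, s0 <= s -> exists2 N,
    covered_by_translates (cube s) A N &
    N%:R * v <= rogers_fun n eta * (2 * s) ^+ n * (1 + d) ^+ (2 * n + 2).
Proof.
move=> n0 bA cv eta01 Aeta d0; have [eta0 eta1] := andP eta01.
have d1 : 0 < 1 + d by rewrite addr_gt0.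
have e1 : 0 < 1 + eta by rewrite addr_gt0.
pose m := ((1 + eta) * (1 + d))^-1.
have m0 : 0 < m by rewrite invr_gt0 mulr_gt0.
pose A' := scale m A; pose v' := m ^+ n * v.
have bA' : body A' := body_scale m0 bA.
have [v'0 cA'] : has_content A' v' := has_content_scale m0 cv.
have AE : scale (1 + d) (scale (1 + eta) A') = A.
  rewrite /A' !scale_scale (_ : _ * _ = 1) ?scale1// [(1 + d) * _]mulrC.
  by rewrite /m mulfV// gt_eqF// mulr_gt0.
have vE : v = ((1 + eta) * (1 + d)) ^+ n * v'.
  by rewrite /v' mulrA -exprMn mulfV ?expr1n ?mul1r// gt_eqF// mulr_gt0.
have [_ [r r0 rA'] [b1 Ab1]] := bA'.
pose b := `|b1|; have b0 : 0 <= b := normr_ge0 _.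
have Ab : A' `<=` cube b by apply: (subset_trans Ab1); apply: cube_sub; exact: ler_norm.
have [h0 h00 H] := cA' d d0.
(* The copy of - eta A' is counted as A' at mesh h / eta, so h / eta must also stay below h0; h <= d
   r is for the rounding. *)
pose h := Num.min (eta * h0 / 2) (d * r).
have hp : 0 < h by rewrite lt_min divr_gt0 ?mulr_gt0.
have hh : h <= eta * h0 / 2 by rewrite ge_min lexx.
have hd : h <= d * r by rewrite ge_min lexx orbT.
have hh1 : h / eta < h0.
  by rewrite ltr_pdivrMr// mulrC; apply: le_lt_trans hh _; have := mulr_gt0 eta0 h00; lra.
have hh0 : h < h0.
  apply: le_lt_trans hh1; rewrite ler_pdivlMr// ler_piMr ?ltW//.
have he0 : 0 < h / eta by rewrite divr_gt0.
have [H1 _] := H h hp hh0; have [H2 _] := H (h / eta) he0 hh1.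
have th : thickens h (scale (1 + eta) A') A.
  rewrite -AE; apply: (body_thickens (r := (1 + eta) * r)) => //.
  - exact: body_scale.
  - by rewrite -scale_cube//; exact: scaleS.
  - apply: (le_trans hd); rewrite ler_pM2l//; apply: ler_peMl (ltW r0) _.
    by rewrite lerDl ltW.
(* The second entry gives 2 (s + h + 2 b) + h <= (1 + d) 2 s; the third, together with s >= 1, gives
   v' <= d (2 s)^n and so absorbs the one extra greedy translate. *)
pose s0 := Num.max 1 (Num.max ((3 * h + 4 * b) / (2 * d)) (v' / d)).
exists s0; first by rewrite lt_max ltr01.
move=> s; rewrite !ge_max => /and3P[s1 s2 s3].
have sp : 0 < s by apply: lt_le_trans s1.
have Aeta' x : A' x -> A' (- eta *: x).
  by rewrite /A' /scale /= scalerA mulrC -scalerA; exact: Aeta.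
have [t [tN tc]] := lattice_rogers_cover bA' hp eta01 Aeta' b0 Ab (ltW sp).
exists (size (map (lattice_point h) t)).
  apply: covered_by_seq => x /tc[y yt [u Au hu]].
  exists (lattice_point h y); first exact: map_f.
  by have := th _ _ Au hu; rewrite addrC subrK.
rewrite size_map.
set L := - _ in tN; set q : R := (lattice_count h (cube _))%:R in tN.
set dd : R := (lattice_count h A')%:R in tN H1.
set ee : R := (lattice_count (h / eta) A')%:R in tN H2.
have L0 : 0 <= L by rewrite oppr_ge0 mulr_ge0_le0// ln_le0// ltW.
pose E := (2 * (s + h + b + b) + h) ^+ n.
have qE : h ^+ n * q <= E by apply: lattice_count_cube_le => //; rewrite !addr_ge0// ltW.
have q0 : 0 <= q by exact: ler0n.
have aux (a c F : R) : 0 < a -> 0 <= c -> v' <= (1 + d) * (a * c) ->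
    a * q <= F -> q / c * v' <= F * (1 + d).
  move=> a0 c0 vc aq; have cp : 0 < c.
    rewrite lt_neqAle c0 andbT; apply: contraTneq vc => <-.
    by rewrite !mulr0 -ltNge.
  rewrite mulrAC ler_pdivrMr//; apply: (le_trans (ler_wpM2l q0 vc)).
  have -> : q * ((1 + d) * (a * c)) = a * q * ((1 + d) * c) by ring.
  rewrite -[leRHS]mulrA; apply: ler_wpM2r => //.
  exact: mulr_ge0 (ltW d1) (ltW cp).
have a1 : q / dd * v' <= E * (1 + d).
  by apply: (aux (h ^+ n)) => //; rewrite exprn_gt0.
have a2 : eta ^+ n * (q / ee) * v' <= E * (1 + d).
  have -> : eta ^+ n * (q / ee) * v' = eta ^+ n * (q / ee * v') by rewrite -mulrA.
  have en0 : 0 < eta ^+ n by rewrite exprn_gt0.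
  rewrite -ler_pdivlMl// (mulrA _ E) (mulrC _ E).
  apply: (aux ((h / eta) ^+ n)) => //; first by rewrite exprn_gt0.
  by rewrite expr_div_n mulrAC ler_pM2r// invr_gt0.
have E2 : E <= ((1 + d) * (2 * s)) ^+ n.
  apply: lerXn2r; rewrite ?nnegrE.
  - by rewrite addr_ge0 ?(ltW hp)// mulr_ge0// !addr_ge0 ?(ltW hp) ?(ltW sp).
  - by rewrite mulr_ge0 ?(ltW d1)// mulr_ge0 ?(ltW sp).
  - by move: s2; rewrite ler_pdivrMr ?mulr_gt0//; lra.
rewrite exprMn in E2; set S := (2 * s) ^+ n in E2 *.
have S0 : 0 < S by rewrite exprn_gt0 ?mulr_gt0.
have vS : v' <= d * S.
  move: s3; rewrite ler_pdivrMr// => /le_trans; apply.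
  rewrite mulrC ler_pM2l// /S; have -> : n = n.-1.+1 by rewrite prednK.
  rewrite exprS; apply: (@le_trans _ _ (2 * s)); first by lra.
  by rewrite ler_peMr ?exprn_ege1//; lra.
have big : (size t)%:R * v' <= v' + (1 + L) * (E * (1 + d)).
  apply: (le_trans (ler_wpM2r (ltW v'0) tN)).
  have := ler_wpM2l L0 a1; rewrite mulrDl mulrDl mul1r.
  by rewrite -(mulrA L) [q / dd * v']mulrA; lra.
rewrite vE mulrCA /rogers_fun -/L exprMn.
have D1 k : 0 < (1 + d) ^+ k by rewrite exprn_gt0.
have -> : (1 + d) ^+ (2 * n + 2) = (1 + d) ^+ n * ((1 + d) * (1 + d) * (1 + d) ^+ n).
  by rewrite mulSn mul1n !exprD; ring.
have -> : (1 + eta) ^+ n * (1 + L) * S * ((1 + d) ^+ n * ((1 + d) * (1 + d) * (1 + d) ^+ n))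
   = (1 + eta) ^+ n * (1 + d) ^+ n * ((1 + L) * S * ((1 + d) * (1 + d) * (1 + d) ^+ n)).
  by ring.
rewrite ler_pM2l ?mulr_gt0 ?exprn_gt0//.
apply: (le_trans big).
have L1 : 0 < 1 + L by rewrite ltr_pwDl.
have b1' : (1 + L) * (E * (1 + d)) <= (1 + L) * ((1 + d) ^+ n * S * (1 + d)).
  by rewrite ler_pM2l// ler_pM2r.
have b2 : d * S <= d * ((1 + L) * S * ((1 + d) * (1 + d) ^+ n)).
  rewrite ler_pM2l// mulrAC; apply: ler_peMl (ltW S0) _.
  apply: mulr_ege1; first by rewrite lerDl.
  by rewrite -exprS exprn_ege1// lerDl ltW.
apply: (le_trans (lerD vS b1')).
apply: (@le_trans _ _ (d * ((1 + L) * S * ((1 + d) * (1 + d) ^+ n))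
   + (1 + L) * ((1 + d) ^+ n * S * (1 + d)))); first by rewrite lerD2r.
by rewrite le_eqVlt; apply/orP; left; apply/eqP; ring.
Qed.
End RogersCover.

(** * Volume against content, and averaging over translates *)

Section VolumeContent.
Variables (R : realType) (n : nat).
Implicit Types (A B : set 'rV[R]_n) (x c : 'rV[R]_n) (y z : 'rV[int]_n).

Lemma le_EFin_mul1Dexp k (a : \bar R) (b : R) : 0 <= b ->
  (forall d : R, 0 < d -> (a <= (b * (1 + d) ^+ k)%:E)%E) -> (a <= b%:E)%E.
Proof.
move=> b0; case: a => [a| |] H; last by rewrite leNye.
  by rewrite lee_fin; apply: (ler_mul1Dexp (k := k)) => // d /H; rewrite lee_fin.
by have := H 1 ltr01; rewrite leye_eq.
Qed.

Lemma volume_ge0 A : (0 <= volume A)%E.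
Proof. exact: tuple_lebesgue_ge0. Qed.

(** A point of A is rounded up to a lattice point of (1 + d) A, so the boxes of side h lying below
    these lattice points, shifted by c, cover the translate. *)
Lemma volume_le_content A v c : body A -> has_content A v ->
  (volume (translate c A) <= v%:E)%E.
Proof.
move=> bA cv; have [v0 _] := cv.
apply: (le_EFin_mul1Dexp (k := n.+1)) => [|d d0]; first exact: ltW.
have d1 : 0 < 1 + d by rewrite addr_gt0.
have [_ [r r0 rA] _] := bA.
have [_ _ Bb] := body_scale d1 bA.
have [_ /(_ d d0)[h0 h00 H]] := has_content_scale d1 cv.
pose h := Num.min (h0 / 2) (d * r).
have hp : 0 < h by rewrite lt_min divr_gt0 ?mulr_gt0.
have hh : h <= h0 / 2 by rewrite ge_min lexx.
have hd : h <= d * r by rewrite ge_min lexx orbT.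
have [|_ H2] := H h hp; first by lra.
have th := body_thickens bA rA d0 hd.
pose s := [seq [tuple (lattice_point h z + c) ord0 i - h | i < n]
          | z : 'rV[int]_n <- lattice_points h (scale (1 + d) A)].
apply: (@le_trans _ _ ((size s)%:R * h ^+ n)%:E).
  apply: tuple_lebesgue_le_boxes => [|t At]; first exact: ltW.
  have [z hz] := lattice_ceil (\row_i (tnth t i : R) - c) hp.
  exists [tuple (lattice_point h z + c) ord0 i - h | i < n].
    apply/mapP; exists z => //; apply/(mem_lattice_points _ hp Bb).
    by have := th _ _ At hz; rewrite addrCA subrr addr0.
  by move=> i; rewrite tnth_mktuple; have := hz i; rewrite !mxE; lra.
rewrite lee_fin size_map mulrC; apply: (le_trans H2).
by rewrite exprS [v * _]mulrC mulrA.
Qed.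

(* Averages, over lattice points y of a cube, the number of translates t j + L
   that meet y + K. *)
Lemma translative_cover (K L B : set 'rV[R]_n) (w : R) N (s b d : R) : K `<=` cube b -> b < s ->
  covered_by_translates (@cube R n s) L N -> body B -> has_content B w ->
  (forall x x', L x -> K x' -> B (x - x')) -> 0 < d ->
  exists2 M, covered_by_translates K L M &
    M%:R * (2 * (s - b)) ^+ n <= N%:R * w * (1 + d) ^+ (2 * n + 1).
Proof.
move=> Kb bs [t tL] bB cw LKB d0.
have d1 : 0 < 1 + d by rewrite addr_gt0.
have [_ [r r0 rB] Bb'] := bB.
have [_ _ Bb] := body_scale d1 bB.
have [_ /(_ d d0)[h0 h00 H]] := has_content_scale d1 cw.
pose e := s - b; have e0 : 0 < e by rewrite subr_gt0.
(* The last entry ensures 2 e <= (1 + d) h floor(2 e / h), so that the lattice points of the cube of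
   radius e account for its volume up to (1 + d)^n. *)
pose h := Num.min (h0 / 2) (Num.min (d * r) (d * (2 * e) / (1 + d))).
have hp : 0 < h by rewrite !lt_min !divr_gt0 ?mulr_gt0.
have hh : h <= h0 / 2 by rewrite ge_min lexx.
have hd : h <= d * r by rewrite !ge_min lexx orbT.
have he : h <= d * (2 * e) / (1 + d) by rewrite !ge_min lexx !orbT.
have [|_ H2] := H h hp; first by lra.
have th := body_thickens bB rB d0 hd.
pose Y := lattice_points h (@cube R n e).
have YP y : y \in Y <-> cube e (lattice_point h y).
  exact: mem_lattice_points hp (cube_bounded _ _).
pose J := [fset j | j in 'I_N]%fset.
have cJ : #|` J| = N by rewrite card_imfset //= -cardT card_ord.
(* If t j + L meets y + K, then y - t j is a difference of a point of L and a point of K, hence in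
   B. For fixed j the y with this property are counted by a translate of B. *)
pose E y (j : 'I_N) := `[< B (lattice_point h y - t j) >].
have Y0 : Y != fset0.
  apply/fset0Pn; exists 0; apply/YP => i; rewrite !mxE mulr0.
  by rewrite oppr_le0 ltW.
have S1 : (\sum_(y <- Y) #|` [fset j in J | E y j]%fset|
    <= N * lattice_count h (scale (1 + d) B))%N.
  rewrite sum_card_exchange -[X in (_ <= X * _)%N]cJ; apply: sum_fset_le => j _.
  apply: leq_trans (lattice_count_shift_le (t j) hp Bb' Bb th).
  have Tb := translate_bounded (t j) Bb'.
  apply/fsubset_leq_card/fsubsetP => y; rewrite !inE => /andP[_ /asboolP By].
  exact/(mem_lattice_points _ hp Tb).
have [y /YP ye yM] := exists_le_average Y0 S1.
pose s' := [seq t j - lattice_point h y | j <- [fset j in J | E y j]%fset].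
exists (size s').
  apply: covered_by_seq => x Kx.
  have /tL[j _ [l Ll ljE]] : cube s (lattice_point h y + x).
    by rewrite -(subrK b s); apply: sum_cube ye (Kb _ Kx).
  exists (t j - lattice_point h y).
    apply/mapP; exists j => //; rewrite !inE /=.
    have -> : lattice_point h y - t j = l - x.
      by apply/eqP; rewrite subr_eq addrAC eq_sym subr_eq addrC ljE addrC.
    exact: LKB.
  have -> : x - (t j - lattice_point h y) = l; last by [].
  by rewrite opprB addrCA addrA -ljE addrC addKr.
rewrite size_map; move: yM; set M := (X in (_ * X <= _)%N) => yM.
have Yge : (2 * e) ^+ n <= (1 + d) ^+ n * (h ^+ n * #|` Y|%:R).
  have c1 : (Num.truncn (2 * e / h) ^ n <= #|` Y|)%N.
    apply: (@lattice_count_ge R n h _ (const_mx (- e)) (2 * e) hp).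
    - by rewrite mulr_ge0// ltW.
    - exact: cube_bounded.
    - by move=> x xe i; have := xe i; rewrite mxE; clear; lra.
  apply: (@le_trans _ _ ((1 + d) ^+ n * (h ^+ n * (Num.truncn (2 * e / h))%:R ^+ n))).
    rewrite -!exprMn; apply: lerXn2r; rewrite ?nnegrE.
    - by rewrite mulr_ge0// ltW.
    - by rewrite mulr_ge0 ?(ltW d1)// mulr_ge0// ltW.
    - have k1 : 2 * e / h < (Num.truncn (2 * e / h))%:R + 1 by rewrite natr1 truncnS_gt.
      move: k1; rewrite ltr_pdivrMr//; move: he; rewrite ler_pdivlMr//.
      move: (Num.truncn _)%:R => k; set f := 2 * e => he k1.
      have : (1 + d) * f <= (1 + d) * ((k + 1) * h) by rewrite ler_pM2l// ltW.
      by move: he; clear; lra.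
  by rewrite ler_pM2l ?exprn_gt0// ler_pM2l ?exprn_gt0// -natrX ler_nat.
apply: (le_trans (ler_wpM2l (ler0n _ _) Yge)).
have -> : M%:R * ((1 + d) ^+ n * (h ^+ n * #|` Y|%:R))
  = (1 + d) ^+ n * (h ^+ n * (#|` Y| * M)%:R) by rewrite natrM; ring.
apply: (@le_trans _ _ ((1 + d) ^+ n *
    (h ^+ n * (N * lattice_count h (scale (1 + d) B))%:R))).
  by rewrite ler_pM2l ?exprn_gt0// ler_pM2l ?exprn_gt0// ler_nat.
have -> : N%:R * w * (1 + d) ^+ (2 * n + 1) =
  (1 + d) ^+ n * (N%:R * ((1 + d) * ((1 + d) ^+ n * w))).
  by rewrite mulSn mul1n !exprD expr1; ring.
rewrite ler_pM2l ?exprn_gt0// natrM mulrCA; apply: ler_wpM2l => //.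
Qed.
End VolumeContent.

(** * The Rogers-Shephard inequality *)

Section RogersShephard.
Variables (R : realType).

(** Counts the subsets of {0, ..., M} with a + b + 1 elements by their element k of rank a + 1. This
    is the discrete Beta integral behind the binomial coefficient in the Rogers-Shephard
    inequality. *)
Lemma sum_bin_mul M a b :
  (\sum_(k < M.+1) 'C(k, a) * 'C(M - k, b) = 'C(M.+1, a + b.+1))%N.
Proof.
elim: M b => [|M IH] b.
  by rewrite big_ord_recl big_ord0 subn0 addnS binS bin0n; case: a b => [|a] [|b].
rewrite big_ord_recr /= subnn.
have E (k : 'I_M.+1) : (M.+1 - k = (M - k).+1)%N by rewrite subSn// -ltnS.
case: b => [|b].
  rewrite addn1 [RHS]binS bin0 muln1; congr (_ + _)%N.
  by rewrite -[a.+1]addn1 -(IH 0%N); apply: eq_bigr => k _; rewrite !bin0.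
under eq_bigr => k _ do rewrite E binS mulnDr.
by rewrite big_split /= !IH bin0n /= muln0 addn0 [in RHS]addnS [RHS]binS -addnS.
Qed.

Lemma ffact_le_exp j n : (j ^_ n <= j ^ n)%N.
Proof. by elim: n => // n IH; rewrite ffactnSr expnSr leq_mul// leq_subr. Qed.

(** The left side is n times a falling factorial of length n - 1, hence at most n j^(n-1), which the
    factored difference of powers dominates. *)
Lemma fact_bin_le j n : (0 < n)%N -> (n`! * 'C(j, n.-1) <= j.+1 ^ n - j ^ n)%N.
Proof.
case: n => // n _; rewrite factS -mulnA [(n`! * _)%N]mulnC bin_ffact.
apply: (@leq_trans (n.+1 * j ^ n)); first by rewrite leq_mul2l ffact_le_exp.
rewrite subn_exp subSnn mul1n -[X in (X * _)%N](card_ord n.+1) -sum_nat_const.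
apply: leq_sum => i _; have iN : (i <= n)%N by rewrite -ltnS.
rewrite /= -{1}(subnK iN) expnD leq_mul//.
by case: (n - i)%N => // e; rewrite leq_exp2r.
Qed.

(** If P first holds at k, the sum is at most the telescoping sum from k to m, which equals a k - a
    m = a k <= g. *)
Lemma abel_indicator_le (a : nat -> R) (P : pred nat) (g : R) m j :
  (j <= m)%N -> (forall k, a k.+1 <= a k) -> a m = 0 -> 0 <= g ->
  (forall k, (j <= k < m)%N -> P k -> a k <= g) ->
  \sum_(j <= k < m) (P k)%:R * (a k - a k.+1) <= g.
Proof.
move=> jm ha am g0; have [l] := ubnP (m - j)%N; elim: l j jm => // l IH j jm lm Pg.
have [mj|jm'] := leqP m j; first by rewrite big_geq.
rewrite big_ltn//; case Pj : (P j); last first.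
  rewrite mul0r add0r; apply: IH => //; first by lia.
  by move=> k /andP[jk km]; apply: Pg; rewrite km andbT ltnW.
rewrite mul1r; apply: (@le_trans _ _ (\sum_(j <= k < m) (a k - a k.+1))).
  rewrite [leRHS]big_ltn// lerD2l; apply: ler_sum => k _.
  by case: (P k); rewrite ?mul1r// mul0r subr_ge0.
have -> : \sum_(j <= k < m) (a k - a k.+1) = a j - a m.
  rewrite -[RHS]opprB -telescope_sumr; last exact: ltnW.
  by rewrite -sumrN; apply: eq_bigr => k _; rewrite opprB.
by rewrite am subr0; apply: Pg; rewrite ?leqnn.
Qed.

Variable n : nat.
Implicit Types (A B : set 'rV[R]_n).

(* If x = l (p - q) with p, q in A, then A and its translate by x both contain
   l p + (1 - l) A. *)
Lemma card_layer_ge A r d h l (x : 'rV[R]_n) : body A -> cube r `<=` A -> 0 < d -> 0 < h ->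
  0 < l < 1 -> h * (1 + d) <= d * r * (1 - l) ->
  scale l (difference_body A) x ->
  (lattice_count (h * (1 + d) / (1 - l)) A
    <= lattice_count h [set y | A y /\ A (y - x)%R])%N.
Proof.
move=> bA rA d0 h0 /andP[l0 l1] hd [p [q [Ap Aq pq]]].
have l1' : 0 < 1 - l by rewrite subr_gt0.
have d1 : 0 < 1 + d by rewrite addr_gt0.
have xE : x = l *: p - l *: q.
  by rewrite -scalerBr -pq scalerA mulfV ?scale1r// gt_eqF.
(* The factor 1 / (1 + d) pays for l p not being a lattice vector. *)
pose B := scale ((1 - l) / (1 + d)) A.
have l2 : 0 < (1 - l) / (1 + d) by rewrite divr_gt0.
have bB : body B := body_scale l2 bA.
have -> : lattice_count (h * (1 + d) / (1 - l)) A = lattice_count h B.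
  by rewrite lattice_count_scale invf_div mulrA.
have BE : scale (1 + d) B = scale (1 - l) A.
  by rewrite /B scale_scale mulrC divfK// gt_eqF.
have th : thickens h B (scale (1 - l) A).
  rewrite -BE; apply: (body_thickens (r := (1 - l) / (1 + d) * r)) => //.
    by rewrite -scale_cube//; exact: scaleS.
  rewrite [_ / _ * r]mulrAC !mulrA ler_pdivlMr//; apply: (le_trans hd).
  by rewrite mulrAC.
have bl := body_scale l1' bA.
have [_ _ Bb] := bB; have [_ _ lb] := bl; have [_ _ Ab] := bA.
apply: (leq_trans (lattice_count_shift_ge (l *: p) h0 Bb lb th)).
apply: lattice_count_sub => //.
  by have [b bb] := Ab; exists b => y [/bb].
have Aone a : A a -> A = scale (1 - l + l) A by rewrite subrK scale1.
have sA a : A a -> scale l A (l *: a) by rewrite /scale /= scalerA mulVf ?scale1r// gt_eqF.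
move=> y yl; split; rewrite -(scale1 A) -(subrK l 1).
  by rewrite -(subrK (l *: p) y); exact: scaleD yl (sA _ Ap).
have -> : y - x = y - l *: p + l *: q by rewrite xE opprB addrCA addrC.
exact: scaleD yl (sA _ Aq).
Qed.

(* Counts the pairs of lattice points of A by their difference x, with x sorted
   into the layers (k / m) (A - A); the sum over k is in Abel-summed form. *)
Lemma rogers_shephard_layers A v w m : (0 < n)%N -> (0 < m)%N -> body A -> has_content A v ->
  has_content (difference_body A) w ->
  w * \sum_(1 <= k < m) ((1 - k%:R / m%:R) ^+ n - (1 - k.+1%:R / m%:R) ^+ n)
        * (k%:R / m%:R) ^+ n <= v.
Proof.
move=> n0 m0 bA [v0 cv] [w0 cw].
have bB := body_difference bA.
have [_ [r r0 rA] Ab] := bA; have [_ _ Bb] := bB.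
have mR : 0 < m%:R :> R by rewrite ltr0n.
(* The exponent collects n + 1 from the lower bound [a] on the pair counts, 1 from the sizes of the
   layers and 2 from the square of #|D|. *)
apply: (ler_mul1Dexp (k := n + 4)) => [|d d0]; first exact: ltW.
have d1 : 0 < 1 + d by rewrite addr_gt0.
have [h1 h10 H1] := cv d d0; have [h2 h20 H2] := cw d d0.
pose e := Num.min (h1 / 2) (Num.min h2 (d * r)).
have e0 : 0 < e by rewrite !lt_min divr_gt0 ?h20 ?mulr_gt0.
(* For 1 <= k < m both k / m and 1 - k / m are at least 1 / m, so every mesh h / l k and h (1 + d) /
   (1 - l k) used below is at most h (1 + d) m = e / 2. *)
pose h := e / (2 * (1 + d) * m%:R).
have hp : 0 < h by rewrite divr_gt0 ?mulr_gt0.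
have hE : h * (1 + d) * m%:R = e / 2.
  by rewrite /h; field; rewrite !gt_eqF.
have m1 : 1 <= m%:R :> R by rewrite ler1n.
have hm : h * m%:R <= e / 2.
  rewrite -hE [leRHS]mulrAC; apply: ler_peMr; last by rewrite lerDl ltW.
  exact: mulr_ge0 (ltW hp) (ltW mR).
have hh : h <= e / 2 by apply: le_trans hm; apply: ler_peMr m1; exact: ltW.
have e1 : e <= h1 / 2 by rewrite ge_min lexx.
have e2 : e <= h2 by rewrite !ge_min lexx orbT.
have e3 : e <= d * r by rewrite !ge_min lexx !orbT.
clearbody h e.
pose D := lattice_points h A; pose X := lattice_points h (difference_body A).
have DP z : z \in D <-> A (lattice_point h z) := mem_lattice_points _ hp Ab.
have XP z : z \in X <-> difference_body A (lattice_point h z) := mem_lattice_points _ hp Bb.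
pose g (x : 'rV[int]_n) : nat := #|` [fset z in D | z - x \in D]%fset|.
pose l k : R := k%:R / m%:R.
pose c := v / ((1 + d) ^+ n.+1 * h ^+ n).
have c0 : 0 < c by rewrite divr_gt0 ?mulr_gt0 ?exprn_gt0.
(* Beyond m the power (1 - l k)^n could increase again when n is even; the cut keeps [a]
   nonincreasing everywhere. *)
pose a k := (if (k <= m)%N then (1 - l k) ^+ n else 0) * c.
pose S k := lattice_points h (scale (l k) (difference_body A)).
have lP k : (1 <= k < m)%N -> [/\ 0 < l k, l k < 1, m%:R^-1 <= l k & m%:R^-1 <= 1 - l k].
  move=> /andP[k1 km]; rewrite /l; split.
  - by rewrite divr_gt0// ltr0n.
  - by rewrite ltr_pdivrMr// mul1r ltr_nat.
  - by rewrite -[X in X <= _]mul1r ler_pM2r ?invr_gt0// ler1n.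
  - rewrite lerBrDr -[X in X + _]mul1r -mulrDl nat1r ler_pdivrMr// mul1r.
    by rewrite ler_nat.
have inv_le (f t : R) : m%:R^-1 <= t -> 0 <= f -> f / t <= f * m%:R.
  move=> mt f0; have t0 : 0 < t by apply: lt_le_trans mt; rewrite invr_gt0 mR.
  by apply: ler_wpM2l => //; rewrite -[leRHS]invrK lef_pV2 ?posrE ?invr_gt0.
have ag x k : (1 <= k < m)%N -> x \in S k -> a k <= (g x)%:R.
  move=> km; have [l0 l1 _ lm] := lP k km.
  have [_ _ Sb] := body_scale l0 bB.
  move=> /(mem_lattice_points _ hp Sb) xS.
  have l1' : 0 < 1 - l k by rewrite subr_gt0.
  have hl : h * (1 + d) <= d * r * (1 - l k).
    rewrite -ler_pdivrMr//; apply: (le_trans (inv_le _ _ lm _)).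
      by rewrite mulr_ge0 ?(ltW hp)// ltW.
    by rewrite hE; apply: le_trans e3; move: e0; clear; lra.
  have := card_layer_ge bA rA d0 hp (introT andP (conj l0 l1)) hl xS.
  set h' := _ / _; rewrite -(ler_nat R) => c1.
  have h'0 : 0 < h' by rewrite divr_gt0 ?mulr_gt0.
  have [|v1 _] := H1 h' h'0.
    apply: (le_lt_trans (inv_le _ _ lm _)); first by rewrite mulr_ge0 ?(ltW hp)// ltW.
    by rewrite hE; move: e0 e1; clear; lra.
  have c2 : (lattice_count h [set y | A y /\ A (y - lattice_point h x)])%:R
      <= (g x)%:R :> R.
    have [b Abb] := Ab.
    rewrite ler_nat; apply/fsubset_leq_card/fsubsetP => z.
    have yb : exists b, [set y | A y /\ A (y - lattice_point h x)] `<=` @cube R n b.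
      by exists b => y [/Abb].
    move=> /(mem_lattice_points _ hp yb)[z1 z2]; rewrite !inE; apply/andP; split.
      exact/DP.
    by apply/DP; rewrite lattice_pointB.
  apply: le_trans c2; apply: le_trans c1.
  rewrite /a ltnW; last by case/andP: km.
  rewrite /c mulrA ler_pdivrMr ?mulr_gt0 ?exprn_gt0//.
  have ln0 : 0 < (1 - l k) ^+ n by rewrite exprn_gt0.
  rewrite -ler_pdivlMl//; apply: (le_trans v1).
  rewrite le_eqVlt; apply/orP; left; apply/eqP.
  rewrite /h' expr_div_n exprMn exprS; move: ln0; set t := _ ^+ n => t0.
  by field; rewrite gt_eqF.
have SX k : (1 <= k < m)%N -> (S k `<=` X)%fset.
  move=> km; have [l0 l1 _ _] := lP k km; have [_ _ Sb] := body_scale l0 bB.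
  apply/fsubsetP => x /(mem_lattice_points _ hp Sb) xS; apply/XP.
  by rewrite -(scale1 (difference_body A)); apply: scale_sub xS => //; exact: ltW.
have gsum : (\sum_(x <- X) g x <= #|` D| * #|` D|)%N.
  rewrite /g (@sum_card_exchange _ _ _ _ (fun x z => z - x \in D)).
  apply: sum_fset_le => z _.
  apply: (@card_le_inj _ _ _ _ (fun x => z - x)) => [x x' _ _ /addrI/oppr_inj//|x].
  by rewrite !inE => /andP[].
pose dl k := (1 - l k) ^+ n - (1 - l k.+1) ^+ n.
have l_le1 k : (k <= m)%N -> 0 <= 1 - l k.
  by move=> km; rewrite subr_ge0 ler_pdivrMr// mul1r ler_nat.
have l_le k : (k < m)%N -> 1 - l k.+1 <= 1 - l k.
  by move=> km; rewrite lerD2l lerN2 ler_pM2r ?invr_gt0// ler_nat.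

have adec k : a k.+1 <= a k.
  rewrite /a; case: (ltnP k m) => km.
    rewrite (ltnW km) ler_pM2r//; apply: lerXn2r; last exact: l_le.
    - by rewrite nnegrE; exact: l_le1.
    - by rewrite nnegrE; exact: l_le1 (ltnW km).
  rewrite mul0r; apply: mulr_ge0 (ltW c0); case: ifP => // km'.
  by apply: exprn_ge0; exact: l_le1.
have am : a m = 0.
  by rewrite /a leqnn /l mulfV ?gt_eqF// subrr expr0n gtn_eqF// mul0r.
have abel : \sum_(x <- X) \sum_(1 <= k < m) (x \in S k)%:R * (a k - a k.+1)
     <= (#|` D| * #|` D|)%:R.
  apply: (@le_trans _ _ (\sum_(x <- X) (g x)%:R)).
    apply: ler_sum => x _.
    apply: (abel_indicator_le (P := fun i => x \in S i) m0 adec am (ler0n _ _)).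
    by move=> i im; exact: ag.
  by rewrite -natr_sum ler_nat.
have abel2 : c * \sum_(1 <= k < m) dl k * #|` S k|%:R <= (#|` D| * #|` D|)%:R.
  apply: le_trans abel; rewrite exchange_big /= mulr_sumr.
  rewrite le_eqVlt; apply/orP; left; apply/eqP.
  rewrite [LHS]big_nat [RHS]big_nat; apply: eq_bigr => k km.
  rewrite -mulr_suml -natr_sum -card_fset_sum.
  have -> : [fset z in X | z \in S k]%fset = S k.
    apply/fsetP => z; rewrite !inE andbC; case zS: (z \in S k) => //=.
    exact: (fsubsetP (SX _ km)).
  have /andP[_ km'] := km.
  by rewrite /a km' ltnW// /dl; ring.
have Sk k : (1 <= k < m)%N -> w * l k ^+ n <= (1 + d) * h ^+ n * #|` S k|%:R.
  move=> km; have [l0 l1 lm _] := lP k km.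
  have h'0 : 0 < h / l k by rewrite divr_gt0.
  have [|w1 _] := H2 _ h'0.
    apply: (le_lt_trans (inv_le _ _ lm (ltW hp))).
    by apply: (le_lt_trans hm); move: e0 e2; clear; lra.
  have -> : #|` S k|%:R = (lattice_count (h / l k) (difference_body A))%:R :> R.
    by rewrite -lattice_count_scale.
  have ln0 : 0 < l k ^+ n by rewrite exprn_gt0.
  rewrite mulrC -ler_pdivlMl//; apply: (le_trans w1).
  rewrite le_eqVlt; apply/orP; left; apply/eqP.
  rewrite expr_div_n; move: ln0; set t := _ ^+ n => t0.
  by field; rewrite gt_eqF.
have [|_ v2] := H1 h hp; first by move: e0 e1 hh; clear; lra.
rewrite -/(lattice_count h A) in v2.
apply: (@le_trans _ _ ((1 + d) * h ^+ n * \sum_(1 <= k < m) dl k * #|` S k|%:R)).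
  rewrite !mulr_sumr big_nat [leRHS]big_nat; apply: ler_sum => k km.
  rewrite -/(l k) -/(l k.+1) -/(dl k) mulrCA [leRHS]mulrCA.
  have /andP[_ km'] := km.
  apply: ler_wpM2l; last exact: Sk.
  rewrite subr_ge0; apply: lerXn2r; last exact: l_le.
  - by rewrite nnegrE; exact: l_le1.
  - by rewrite nnegrE; exact: l_le1 (ltnW km').
rewrite -(ler_pM2l c0).
have hn0 : 0 < h ^+ n by rewrite exprn_gt0.
apply: (@le_trans _ _ ((1 + d) * h ^+ n * (#|` D| * #|` D|)%:R)).
  by rewrite mulrCA ler_pM2l ?mulr_gt0.
rewrite natrM; set D' : R := #|` D|%:R.
have v3 : h ^+ n * D' <= (1 + d) * v by [].
have D'0 : 0 <= h ^+ n * D' by rewrite mulr_ge0 ?ler0n// ltW.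
have := ler_pM D'0 D'0 v3 v3 => v4.
rewrite -(ler_pM2l hn0).
have -> : h ^+ n * ((1 + d) * h ^+ n * (D' * D')) = (1 + d) * (h ^+ n * D' * (h ^+ n * D')).
  by ring.
have -> : h ^+ n * (c * (v * (1 + d) ^+ (n + 4))) = (1 + d) * ((1 + d) * v * ((1 + d) * v)).
  rewrite /c exprS exprD; have : (1 + d) ^+ n != 0 by rewrite gt_eqF ?exprn_gt0.
  move: (gt_eqF hn0) (gt_eqF d1).
  move: (h ^+ n) ((1 + d) ^+ n) => x y; set z := 1 + d => x0 z0 y0; field.
  by rewrite x0 z0 y0.
by rewrite ler_pM2l.
Qed.
(** The right side is a Stieltjes sum for the integral of n (1 - x)^(n-1) x^n over [0, 1], which is
    n! n! / (2n)!. Replacing powers by falling factorials bounds it below by a convolution of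
    binomials that [sum_bin_mul] evaluates exactly. *)
Lemma layer_sum_ge m : (0 < n)%N -> (0 < m)%N ->
  (n`! * n`! * 'C(m, n + n))%:R / m%:R ^+ (n + n) <=
  \sum_(1 <= k < m) ((1 - k%:R / m%:R) ^+ n - (1 - k.+1%:R / m%:R) ^+ n)
        * (k%:R / m%:R) ^+ n :> R.
Proof.
move=> n0 m0; have mR : 0 < m%:R :> R by rewrite ltr0n.
have -> : 'C(m, n + n) = (\sum_(1 <= k < m) 'C(k, n) * 'C(m - k.+1, n.-1))%N.
  have := sum_bin_mul m.-1 n n.-1; rewrite !prednK// => <-.
  rewrite -(big_mkord xpredT (fun k => 'C(k, n) * 'C(m.-1 - k, n.-1))%N).
  rewrite [in LHS]big_ltn// bin0n eqn0Ngt n0 mul0n add0n.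
  by apply: eq_bigr => k _; rewrite subnS; congr (_ * 'C(_, _))%N; case: (m) => //= ?; rewrite ?subSS; lia.
rewrite big_distrr /= natr_sum mulr_suml [leLHS]big_nat [leRHS]big_nat.
apply: ler_sum => k /andP[k1 km].
have lE i : (i <= m)%N -> 1 - i%:R / m%:R = (m - i)%:R / m%:R :> R.
  by move=> im; rewrite natrB// mulrBl mulfV// gt_eqF.
rewrite (lE _ km) (lE _ (ltnW km)) !expr_div_n -mulrBl exprD.
have -> : (n`! * n`! * ('C(k, n) * 'C(m - k.+1, n.-1)))%:R / (m%:R ^+ n * m%:R ^+ n)
  = (n`! * 'C(m - k.+1, n.-1))%:R / m%:R ^+ n * ((n`! * 'C(k, n))%:R / m%:R ^+ n) :> R.
  by rewrite !natrM invfM; ring.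
have mn0 : 0 <= (m%:R ^+ n)^-1 :> R by rewrite invr_ge0 exprn_ge0.
apply: ler_pM; rewrite ?mulr_ge0 ?ler0n// ler_wpM2r// -!natrX.
  rewrite -natrB ?leq_exp2r ?leq_sub2l// ler_nat.
  by have := fact_bin_le (m - k.+1) n0; rewrite subnSK.
rewrite ler_nat mulnC bin_ffact.
exact: ffact_le_exp.
Qed.

Lemma rogers_shephard A v w : (0 < n)%N -> body A -> has_content A v ->
  has_content (difference_body A) w -> w <= 'C(2 * n, n)%:R * v.
Proof.
move=> n0 bA cv cw; have [v0 _] := cv; have [w0 _] := cw.
apply: (ler_mul1Dexp (k := n + n)) => [|d d0]; first by rewrite mulr_ge0 ?ler0n// ltW.
(* With m = j + 2n, the falling factorial of m of length 2n is at least j^(2n), and j > 2n / d gives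
   m <= (1 + d) j. *)
have [j jP] : exists j : nat, (n + n)%:R / d < j%:R.
  by exists (Num.truncn ((n + n)%:R / d)).+1; exact: truncnS_gt.
have j0 : 0 < j%:R :> R by apply: le_lt_trans jP; rewrite divr_ge0// ltW.
pose m := (j + (n + n))%N; have m0 : (0 < m)%N by rewrite addn_gt0 -(ltr0n R) j0.
have mR : 0 < m%:R :> R by rewrite ltr0n.
have H : w * ((n`! * n`! * 'C(m, n + n))%:R / m%:R ^+ (n + n)) <= v.
  apply: le_trans (rogers_shephard_layers n0 m0 bA cv cw).
  by rewrite ler_pM2l//; exact: layer_sum_ge.
have F : ((n + n)`! = 'C(2 * n, n) * (n`! * n`!))%N.
  by rewrite mul2n -addnn -[X in _ = (_ * (_ * X`!))%N](addKn n n) bin_fact// leq_addr.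
have jle : (j ^ (n + n) <= m ^_ (n + n))%N.
  rewrite ffact_prod -{1}(card_ord (n + n)) -prod_nat_const.
  by apply: leq_prod => i _; rewrite /m -addnBA ?leq_addr// ltnW.
have Bin : ('C(m, n + n) * ('C(2 * n, n) * (n`! * n`!)) = m ^_ (n + n))%N.
  by rewrite -F bin_ffact.
have jk0 : 0 < j%:R ^+ (n + n) :> R by rewrite exprn_gt0.
have mk0 : 0 < m%:R ^+ (n + n) :> R by rewrite exprn_gt0.
have K1 : w * j%:R ^+ (n + n) <= 'C(2 * n, n)%:R * v * m%:R ^+ (n + n).
  move: H; rewrite mulrA ler_pdivrMr// => H.
  apply: (@le_trans _ _ (w * (m ^_ (n + n))%:R)).
    by rewrite ler_pM2l// -natrX ler_nat.
  rewrite -Bin natrM [('C(2 * n, n) * _)%:R]natrM.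
  have := ler_wpM2l (ler0n R 'C(2 * n, n)) H; rewrite [(_ * 'C(m, _))%:R]natrM.
  by rewrite !mulrA; congr (_ <= _); ring.
have K2 : m%:R <= j%:R * (1 + d).
  rewrite /m natrD mulrDr mulr1 lerD2l; move: jP; rewrite ltr_pdivrMr//.
  exact: ltW.
rewrite -(ler_pM2r jk0); apply: (le_trans K1).
rewrite -[leRHS]mulrA -exprMn [(1 + d) * _]mulrC; apply: ler_wpM2l.
  by rewrite mulr_ge0 ?ler0n// ltW.
apply: lerXn2r => //; rewrite nnegrE; first exact: ltW.
by rewrite mulr_ge0 ?ltW ?addr_gt0.
Qed.

End RogersShephard.

(** * Centers of convex bodies *)

Section Center.
Variables (R : realType) (n : nat).
Implicit Types (K : set 'rV[R]_n) (x c : 'rV[R]_n).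

Lemma convex_setE K : convex_set K -> segment_closed K.
Proof.
move=> cK x y t Kx Ky /andP[t0 t1].
have /= := cK x y (Itv01 t0 t1); rewrite !inE; exact.
Qed.

Lemma mx_entry_le_norm x i : `|x ord0 i| <= `|x|.
Proof.
have /mapP[j Hj ->] : `|x ord0 i| \in [seq `|x k.1 k.2| | k : 'I_1 * 'I_n].
  by apply/mapP; exists (ord0, i) => //=; rewrite mem_enum.
by rewrite [leRHS]/Num.norm /= mx_normrE; apply/bigmax_geP; right => /=; exists j.
Qed.

Lemma compact_cube K : compact K -> exists b, K `<=` @cube R n b.
Proof.
move=> /compact_bounded[M [_ KM]]; exists (M + 1) => x Kx i.
have M1 : M < M + 1 by rewrite ltrDl.
have /= xM := KM _ M1 x Kx.
by rewrite -ler_norml; apply: le_trans xM; exact: mx_entry_le_norm.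
Qed.

Lemma interior_cube K a : (K° a) <-> exists2 r, 0 < r & forall x, cube r x -> K (a + x).
Proof.
split.
  move=> /nbhs_ballP[e /= e0 aK]; exists (e / 2); first exact: divr_gt0.
  move=> x xe; apply: aK; split=> // i j; rewrite ord1 /ball /= !mxE opprD addNKr normrN.
  have := xe j; rewrite -ler_norml => /le_lt_trans; apply.
  by rewrite ltr_pdivrMr// mulr2n mulrDr mulr1 ltrDl.
move=> [r r0 aK]; apply/nbhs_ballP; exists r => //= x [_ ax].
have -> : x = a + (x - a) by rewrite addrCA subrr addr0.
apply: aK => i; rewrite -ler_norml !mxE distrC.
exact: ltW (ax ord0 i).
Qed.

Lemma convex_combination K m (l : 'I_m.+1 -> R) (v : 'I_m.+1 -> 'rV[R]_n) :
  segment_closed K -> (forall i, 0 <= l i) -> \sum_i l i = 1 ->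
  (forall i, K (v i)) -> K (\sum_i l i *: v i).
Proof.
move=> cK; elim: m l v => [|m IH] l v l0 l1 Kv.
  by move: l1; rewrite !big_ord1 => ->; rewrite scale1r.
move: l1; rewrite big_ord_recl => l1; rewrite big_ord_recl.
have [e|ne] := eqVneq (l ord0) 1.
  have z : \sum_(i < m.+1) l (lift ord0 i) = 0.
    by apply: (addrI (l ord0)); rewrite l1 addr0 e.
  rewrite e scale1r big1 ?addr0// => i _.
  have /eqP := z; rewrite psumr_eq0 => [/allP/(_ i)|? _]; last exact: l0.
  by rewrite mem_index_enum => /(_ isT)/eqP ->; rewrite scale0r.
have s0 : 0 <= \sum_(i < m.+1) l (lift ord0 i) by apply: sumr_ge0 => i _; exact: l0.
have t0 : 1 - l ord0 != 0 by rewrite subr_eq0 eq_sym.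
have -> : \sum_(i < m.+1) l (lift ord0 i) *: v (lift ord0 i)
   = (1 - l ord0) *: \sum_(i < m.+1) ((1 - l ord0)^-1 * l (lift ord0 i)) *: v (lift ord0 i).
  by rewrite scaler_sumr; apply: eq_bigr => i _; rewrite scalerA mulrA mulfV// mul1r.
apply: cK; [exact: Kv| |by rewrite l0; lra].
apply: IH => // [i|].
  by rewrite mulr_ge0// invr_ge0; lra.
rewrite -mulr_sumr (_ : \sum_(i < m.+1) _ = 1 - l ord0) ?mulVf//.
by rewrite -l1 addrC addKr.
Qed.

(* A point of - eta K balances an interior point, which puts 0 in the interior. *)
Lemma neg_closed_body K a r eta : segment_closed K ->
  (exists b, K `<=` @cube R n b) -> 0 < r -> (forall x, cube r x -> K (a + x)) ->
  0 < eta -> (forall x, K x -> K (- eta *: x)) -> body K.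
Proof.
move=> cK Kb r0 aK eta0 key; split=> //.
have h1 : 0 < 1 + eta by rewrite addr_gt0.
(* Weights eta / (1 + eta) on a + w and 1 / (1 + eta) on - eta a cancel a and leave eta / (1 + eta)
   w. *)
exists (eta / (1 + eta) * r); first by rewrite mulr_gt0 ?divr_gt0.
rewrite -scale_cube ?divr_gt0// => x xr.
have := aK _ xr; set w := (eta / (1 + eta))^-1 *: x => Kw.
have Ka : K (- eta *: a).
  by apply: key; rewrite -[a]addr0; apply: aK => i; rewrite mxE oppr_le0 (ltW r0).
have := cK _ _ (eta / (1 + eta)) Kw Ka.
have -> : eta / (1 + eta) *: (a + w) + (1 - eta / (1 + eta)) *: (- eta *: a) = x.
  by rewrite /w; apply/rowP => i; rewrite !mxE; field; rewrite !gt_eqF.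
apply; apply/andP; split; first by rewrite divr_ge0 ?ltW.
by rewrite ler_pdivrMr// mul1r lerDr.
Qed.

(** The absolute value of the determinant is n! times the volume of the simplex whose vertices are
    the rows of v. *)
Let aff (v : 'M[R]_(1 + n, n)) : 'M[R]_(1 + n) := row_mx (const_mx 1) v.

(** The vertices are a and the points a + r e_j; a factorization into block triangular matrices
    gives the determinant r^n. *)
Lemma exists_simplex K a r : 0 < r -> (forall x, cube r x -> K (a + x)) ->
  exists2 v : 'M[R]_(1 + n, n), forall i, K (row i v) & \det (aff v) != 0.
Proof.
move=> r0 aK; pose B : 'M[R]_n := const_mx 1 *m a + r%:M.
exists (col_mx a B).
  move=> i; case: (split_ordP i) => j ->.
    suff -> : row (lshift n j) (col_mx a B) = a + 0.
      by apply: aK => k; rewrite mxE oppr_le0 (ltW r0).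
    by apply/rowP => k; rewrite addr0 mxE col_mxEu ord1.
  suff -> : row (rshift 1 j) (col_mx a B) = a + r *: delta_mx ord0 j.
    apply: aK => k; rewrite !mxE eqxx /=.
    by case: (k == j) => /=; rewrite ?mulr1 ?mulr0 ?oppr_le0 ?(ltW r0)// lexx andbT; lra.
  apply/rowP => k; rewrite mxE col_mxEd !mxE eqxx /= big_ord1 !mxE mul1r.
  by rewrite eq_sym mulr_natr.
have -> : aff (col_mx a B) = block_mx 1%:M 0 (const_mx 1) r%:M *m block_mx 1%:M a 0 1%:M.
  rewrite mulmx_block /aff /B !mul1mx !mul0mx !mulmx0 !mulmx1 !addr0 block_mxEh.
  rewrite -[const_mx 1 in LHS]col_mx_const; congr (row_mx (col_mx _ _) _).
  by apply/matrixP => p q; rewrite !ord1 !mxE.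
rewrite det_mulmx det_lblock det_ublock !det1 det_scalar !mul1r mulr1.
by rewrite expf_neq0// gt_eqF.
Qed.

Definition replace_row (v : 'M[R]_(1 + n, n)) (i : 'I_(1 + n)) x :=
  \matrix_(k, j) if k == i then x ord0 j else v k j.

(* Cramer's rule for barycentric coordinates. *)
Lemma barycentric (v : 'M[R]_(1 + n, n)) x : \det (aff v) != 0 ->
  exists l : 'I_(1 + n) -> R,
    [/\ \sum_i l i = 1, \sum_i l i *: row i v = x &
        forall i, \det (aff (replace_row v i x)) = l i * \det (aff v)].
Proof.
move=> d0; have u : aff v \in unitmx by rewrite unitmxE unitfE.
pose y : 'rV[R]_(1 + n) := row_mx (const_mx 1) x.
have [l lD] : exists l, l = y *m invmx (aff v) by eexists.
have lE : row_mx (l *m const_mx 1) (l *m v) = y.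
  by rewrite -mul_mx_row lD mulmxKV.
have [l1 l2] := eq_row_mx lE.
exists (fun i => l ord0 i); split.
- have /matrixP/(_ ord0 ord0) := l1; rewrite !mxE => <-.
  by apply: eq_bigr => i _; rewrite !mxE mulr1.
- by rewrite -l2 mulmx_sum_row.
move=> i; rewrite (expand_det_row _ i) lD /invmx u -scalemxAr mxE mulrAC mulVf//.
rewrite mul1r mxE; apply: eq_bigr => k _; congr (_ * _).
  rewrite /aff /y !mxE; case: splitP => j kj; rewrite !mxE ?eqxx//.
rewrite [RHS]mxE /cofactor; congr (_ * \det _); apply/matrixP => p q; rewrite !mxE.
by case: splitP => j _; rewrite !mxE// eq_sym (negbTE (neq_lift _ _)).
Qed.

(* The center is the centroid of a simplex with vertices in K whose volume is
   almost maximal: all barycentric coordinates of a point of K are then at most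
   1 + e, so those of the image under the dilation of ratio - eta stay
   nonnegative. *)
Lemma exists_center K eta : segment_closed K -> (exists b, K `<=` cube b) -> K° !=set0 ->
  0 < eta -> n%:R * eta < 1 ->
  exists c, body (translate (- c) K) /\
    forall x, translate (- c) K x -> translate (- c) K (- eta *: x).
Proof.
move=> cK [b Kb] [a /interior_cube[r r0 aK]] eta0 neta.
have [v0 Kv0 dv0] := exists_simplex r0 aK.
pose S := [set `|\det (aff v)| | v in [set v : 'M[R]_(1 + n, n) | forall i, K (row i v)]].
have Sub : has_sup S.
  split; first by exists `|\det (aff v0)|; exists v0.
  exists (\sum_(s : {perm 'I_(1 + n)}) \prod_(i < (1 + n)%N) (`|b| + 1)) => _ [v /= Kv <-].
  apply: (le_trans (ler_norm_sum _ _ _)); apply: ler_sum => s _.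
  rewrite normrM normr_sign mul1r normr_prod; apply: ler_prod => i _.
  rewrite normr_ge0 /= /aff mxE; case: splitP => j _.
    by rewrite mxE normr1 lerDr.
  have := Kb _ (Kv i) j; rewrite mxE -ler_norml => /le_trans; apply.
  by apply: (le_trans (ler_norm b)); rewrite lerDl.
have sp : 0 < sup S.
  apply: (@lt_le_trans _ _ `|\det (aff v0)|); first by rewrite normr_gt0.
  by apply: ub_le_sup; [exact: Sub.2|exists v0].
(* The solution of eta (1 + e) = (1 + eta) / (n + 1): since - eta x + c = (1 + eta) c - eta (x + c),
   its coordinates (1 + eta) / (n + 1) - eta l_i are nonnegative once l_i <= 1 + e. It is positive
   because n eta < 1. *)
pose e := (1 - n%:R * eta) / (eta * (n%:R + 1)).
have n1 : 0 < n%:R + 1 :> R by rewrite ltr_wpDl.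
have e0 : 0 < e by rewrite divr_gt0 ?subr_gt0// mulr_gt0.
have e1 : 0 < 1 + e by rewrite addr_gt0.
have [_ [v /= Kv <-] vs] : exists2 x, S x & sup S / (1 + e) < x.
  by apply: sup_gt; [exact: Sub.1|rewrite ltr_pdivrMr// ltr_pMr// ltrDl].
have dv : \det (aff v) != 0.
  by rewrite -normr_gt0; apply: lt_trans vs; rewrite divr_gt0.
pose c := \sum_i (n%:R + 1)^-1 *: row i v.
exists c.
have tE x : translate (- c) K x = K (x + c) by rewrite /translate /= opprK.
have key x : translate (- c) K x -> translate (- c) K (- eta *: x).
  rewrite !tE => Kx.
  have [l [l1 lx li]] := barycentric (x + c) dv.
  (* Replacing vertex i by x + c multiplies the determinant by l i, and the new simplex still has
     its vertices in K, so its determinant is at most sup S in absolute value. *)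
  have le i : l i <= 1 + e.
    apply: (le_trans (ler_norm _)).
    rewrite -(ler_pM2r (x := `|\det (aff v)|)) ?normr_gt0// -normrM -li.
    apply: (@le_trans _ _ (sup S)).
      apply: ub_le_sup; [exact: Sub.2|exists (replace_row v i (x + c)) => // k].
      have [ki|ki] := eqVneq k i.
        suff -> : row k (replace_row v i (x + c)) = x + c by [].
        by apply/rowP => j; rewrite !mxE ki eqxx.
      suff -> : row k (replace_row v i (x + c)) = row k v by [].
      by apply/rowP => j; rewrite !mxE (negbTE ki).
    by rewrite mulrC -ler_pdivrMr// ltW.
  have -> : - eta *: x + c
      = \sum_i ((1 + eta) / (n%:R + 1) - eta * l i) *: row i v.
    have E1 : \sum_i ((1 + eta) / (n%:R + 1)) *: row i v = (1 + eta) *: c.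
      by rewrite /c scaler_sumr; apply: eq_bigr => i _; rewrite scalerA.
    have E2 : \sum_i (eta * l i) *: row i v = eta *: (x + c).
      by rewrite -lx scaler_sumr; apply: eq_bigr => i _; rewrite scalerA.
    under eq_bigr do rewrite scalerBl.
    rewrite sumrB E1 E2 scalerDr scalerDl scale1r scaleNr.
    by rewrite opprD [- _ - _]addrC addrA addrK addrC.
  apply: convex_combination => // [i|].
    rewrite subr_ge0; apply: (@le_trans _ _ (eta * (1 + e))); first by rewrite ler_pM2l.
    rewrite ler_pdivlMr// /e -mulrA mulrDl mul1r.
    rewrite [_ / _ * _](_ : _ = (1 - n%:R * eta) / eta); last first.
      by field; rewrite !gt_eqF.
    by rewrite mulrDr [eta * (_ / _)]mulrC divfK ?gt_eqF//; lra.
  have El : \sum_i eta * l i = eta by rewrite -mulr_sumr l1 mulr1.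
  have E1 : \sum_(i < 1 + n) (1 + eta) / (n%:R + 1) = 1 + eta.
    rewrite sumr_const card_ord -[LHS]mulr_natr -[(1 + n)%N]/(n.+1) -natr1.
    by rewrite divfK// gt_eqF.
  by rewrite sumrB El E1 addrK.
have bb : exists b, translate (- c) K `<=` cube b := translate_bounded (- c) (ex_intro _ b Kb).
split=> //; apply: (@neg_closed_body _ (a - c) r eta) => //.
- move=> x y t; rewrite !tE => Kx Ky t01.
  have -> : t *: x + (1 - t) *: y + c = t *: (x + c) + (1 - t) *: (y + c).
    by rewrite !scalerDr addrACA -scalerDl addrC [t + _]addrC subrK scale1r addrC.
  exact: cK.
- by move=> x xr; rewrite tE addrAC subrK; exact: aK.
Qed.
End Center.

(** * The function f_n *)

Section RogersFunction.
Variable R : realType.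

(** From exp(-1/6) >= 5/6 follows e <= (6/5)^6 < 2.99. *)
Lemma ln3_gt1 : 1 < ln 3 :> R.
Proof.
rewrite -(ltr_expR 1) lnK ?posrE//.
have e6 : expR (- 6%:R^-1) >= 5%:R / 6%:R :> R.
  by apply: le_trans (expR_ge1Dx _); lra.
have e1 : expR (- 1) = expR (- 6%:R^-1) ^+ 6 :> R.
  by rewrite -expRM_natl; congr expR; lra.
have : (5%:R / 6%:R) ^+ 6 <= expR (- 1) :> R.
  by rewrite e1; apply: lerXn2r; rewrite ?nnegrE ?expR_ge0//; lra.
rewrite expRN => h.
have E0 : 0 < expR 1 :> R := expR_gt0 1.
have : expR 1 * (5%:R / 6%:R) ^+ 6 <= 1 :> R.
  by rewrite mulrC -ler_pdivlMr// mul1r.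
by rewrite !exprS expr0; lra.
Qed.

Lemma is_derive_rogers_fun n (x : R) : 0 < x ->
  is_derive x 1 (rogers_fun n)
    (n%:R * (1 + x) ^+ n.-1 * (1 - n%:R * ln x) - (1 + x) ^+ n * (n%:R / x)).
Proof.
move=> x0.
have -> : rogers_fun n = ((@cst R R 1 + id) ^+ n * (@cst R R 1 - n%:R *: (@ln R))).
  by apply/funext => y; rewrite /rogers_fun /= !fctE.
have dl := is_derive1_ln x0.
apply: is_derive_eq.
by rewrite !fctE /GRing.scale /=; ring.
Qed.

Lemma rogers_fun_ge1 n (x : R) : 0 < x -> x <= 1 ->
  1 - n%:R * ln x <= rogers_fun n x.
Proof.
move=> x0 x1; rewrite /rogers_fun; apply: ler_peMl.
  by rewrite subr_ge0; apply: (@le_trans _ _ 0); rewrite ?mulr_ge0_le0 ?ln_le0.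
by rewrite exprn_ege1// lerDl ltW.
Qed.

(* The derivative at x has the sign of - n ln x - 1 / x, which is positive for
   1 / (n ln n) < x <= 1 / n; this interval is nonempty since ln n > 1, and it
   keeps the minimum away from the right end point. *)
Lemma rogers_fun_min n : (3 <= n)%N ->
  exists2 x : R, 0 < x < n%:R^-1 &
    forall y, 0 < y < n%:R^-1 -> rogers_fun n x <= rogers_fun n y.
Proof.
move=> n3.
have nR : 0 < n%:R :> R by rewrite ltr0n; case: (n) n3.
have ni0 : 0 < n%:R^-1 :> R by rewrite invr_gt0.
have ln1 : 1 < ln n%:R :> R.
  by apply: (lt_le_trans ln3_gt1); rewrite ler_ln ?posrE// ler_nat.
have l0 : 0 < ln n%:R :> R by apply: lt_trans ln1.
pose q := (n%:R * ln n%:R)^-1 : R.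
have q0 : 0 < q by rewrite invr_gt0 mulr_gt0.
have qn : q < n%:R^-1 by rewrite /q invfM gtr_pMr// invf_lt1.
pose x1 := (q + n%:R^-1) / 2.
have qx : q < x1 by rewrite /x1; lra.
have xn : x1 < n%:R^-1 by rewrite /x1; lra.
have x10 : 0 < x1 by apply: lt_trans qx.
have ni1 : n%:R^-1 <= 1 :> R by rewrite invf_le1// ler1n; case: (n) n3.
have der (y : R) : 0 < y -> derivable (rogers_fun n) y 1.
  by move=> y0; have [] := is_derive_rogers_fun n y0.
have cont (a b : R) : 0 < a -> {within `[a, b], continuous (rogers_fun n : R -> R)}.
  move=> a0; apply: derivable_within_continuous => y; rewrite in_itv/= => /andP[ay _].
  by apply: der; apply: lt_le_trans ay.
have incr y : x1 <= y -> y < n%:R^-1 -> rogers_fun n x1 <= rogers_fun n y.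
  move=> xy yn.
  apply: (@ger0_derive1_ndecr R (rogers_fun n) x1 n%:R^-1) => //; last 2 first.
  - exact: cont.
  - exact: ltW.
  - move=> z; rewrite in_itv/= => /andP[xz _]; apply: der; exact: lt_trans xz.
  move=> z; rewrite in_itv/= => /andP[xz zn].
  have z0 : 0 < z by apply: lt_trans xz.
  have [_ dE] := is_derive_rogers_fun n z0.
  rewrite derive1E dE.
  have lz : ln n%:R <= - ln z.
    by rewrite -lnV ?posrE// ler_ln ?posrE ?invr_gt0// -[leLHS]invrK lef_pV2 ?posrE// ltW.
  have zi : z^-1 <= n%:R * ln n%:R.
    rewrite -[leRHS]invrK lef_pV2 ?posrE//; apply: ltW; exact: lt_trans xz.
  have zz : z^-1 <= n%:R * - ln z by apply: (le_trans zi); rewrite ler_pM2l.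
  have -> : (1 + z) ^+ n * (n%:R / z) = n%:R * (1 + z) ^+ n.-1 * (1 + z^-1).
    rewrite -{1}(@prednK n); last by case: (n) n3.
    by rewrite exprS; field; rewrite gt_eqF.
  rewrite -mulrBr; apply: mulr_ge0; last by rewrite mulrN in zz; lra.
  by rewrite mulr_ge0 ?ler0n// exprn_ge0// addr_ge0// ltW.
pose f1 := rogers_fun n x1.
(* Below this point 1 - n ln y already exceeds f1, so the minimum over [a, x1] is not undercut near
   0. *)
pose a := Num.min x1 (expR ((1 - f1) / n%:R)).
have a0 : 0 < a by rewrite lt_min x10 expR_gt0.
have ax : a <= x1 by rewrite ge_min lexx.
have [c] := EVT_min ax (cont _ _ a0).
rewrite in_itv/= => /andP[ac cx] cmin.
exists c; first by rewrite (lt_le_trans a0)//= (le_lt_trans cx).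
have c1 : rogers_fun n c <= f1 by apply: cmin; rewrite in_itv/= ax lexx.
move=> y /andP[y0 yn]; have [yx|xy] := leP y x1; last first.
  by apply: (le_trans c1); apply: incr => //; exact: ltW.
have [ay|ya] := leP a y; first by apply: cmin; rewrite in_itv/= ay.
apply: (le_trans c1); apply: le_trans (rogers_fun_ge1 n y0 _); last first.
  by apply: le_trans ni1; exact: ltW.
have : ln y <= (1 - f1) / n%:R.
  rewrite -[leRHS]expRK ler_ln ?posrE ?expR_gt0//; apply: ltW.
  by apply: (lt_le_trans ya); rewrite ge_min lexx orbT.
by rewrite ler_pdivlMr// mulrC; lra.
Qed.

End RogersFunction.

(** * Covering densities *)

Section CoverDensity.
Variables (R : realType) (n : nat).
Implicit Types (A K : set 'rV[R]_n) (c x : 'rV[R]_n).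

Lemma covered_translate A K c N :
  covered_by_translates A (translate c K) N -> covered_by_translates A K N.
Proof.
move=> [t tA]; exists (fun j => t j + c) => x /tA[j _ [y Ky yx]].
by exists j => //; exists (y - c) => //; rewrite -yx addrA addrAC addrK.
Qed.

Lemma covered_translate_left A K c N :
  covered_by_translates A K N -> covered_by_translates (translate c A) K N.
Proof.
move=> [t tA]; exists (fun j => t j + c) => x /tA[j _ [y Ky yx]].
by exists j => //; exists y => //; rewrite addrAC yx subrK.
Qed.

Lemma covered_sub A A' K N : A' `<=` A ->
  covered_by_translates A K N -> covered_by_translates A' K N.
Proof. by move=> AA [t tA]; exists t => x /AA; exact: tA. Qed.

(** The k^n cubes of radius s centered at the points [g w] fill the cube of radius k s. The strict
    inequality S < k s keeps the grid index of every coordinate below k. *)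
Lemma covered_cube_grid K s S N k : 0 < s -> 0 <= S -> S < k%:R * s ->
  covered_by_translates (cube s) K N -> covered_by_translates (cube S) K (k ^ n * N).
Proof.
move=> s0 S0 Sk [t tK].
pose g (w : 'rV['I_k]_n) : 'rV[R]_n := \row_i ((2 * (w ord0 i)%:R + 1 - k%:R) * s).
pose q := [seq g w + t j | w <- enum {: 'rV['I_k]_n}, j <- enum 'I_N].
have -> : (k ^ n * N)%N = size q.
  by rewrite size_allpairs -!cardE card_mx !card_ord mul1n.
apply: covered_by_seq => x xS.
have H i : (Num.truncn ((x ord0 i + k%:R * s) / (2 * s)) < k)%N.
  have /andP[x1 x2] := xS i.
  rewrite truncn_lt_nat; last by rewrite divr_ge0//; lra.
  by rewrite ltr_pdivrMr ?mulr_gt0//; lra.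
pose w : 'rV['I_k]_n := \row_i Ordinal (H i).
have : cube s (x - g w).
  move=> i; rewrite !mxE /=; have /andP[x1 x2] := xS i.
  set y := (x ord0 i + k%:R * s) / (2 * s).
  have y0 : 0 <= y by rewrite divr_ge0//; lra.
  have xE : x ord0 i = y * (2 * s) - k%:R * s.
    by rewrite /y divfK ?addrK// gt_eqF// mulr_gt0.
  have /andP[k1 k2] := truncn_itv y0.
  rewrite xE; move: k1 k2; rewrite -natr1; move: (Num.truncn y)%:R => p k1 k2.
  have : p * s <= y * s by rewrite ler_pM2r.
  have : y * s < (p + 1) * s by rewrite ltr_pM2r.
  by move: s0; clear; lra.
move=> /tK[j _ [y Ky yx]]; exists (g w + t j).
  by apply/allpairsP; exists (w, j); rewrite !mem_enum.
by rewrite opprD addrA -yx addrC addKr.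
Qed.

(** As in Fekete's lemma, the limit is the infimum: an s with f s almost minimal controls f S for
    all S much larger than s. *)
Lemma cvg_covering_function (f : R -> R) : (forall s, 0 < s -> 0 <= f s) ->
  (forall s S, 0 < s -> 0 < S -> f S <= f s * (1 + s / S) ^+ n) ->
  exists2 l, f s @[s --> +oo] --> l & forall s, 0 < s -> l <= f s.
Proof.
move=> f0 fS; pose E := [set f s | s in [set s | 0 < s]].
have Elb : has_inf E.
  split; last by exists 0 => _ [s s0 <-]; exact: f0.
  by exists (f 1); exists 1 => //=.
have infE s : 0 < s -> inf E <= f s by move=> s0; apply: ge_inf; [exact: Elb.2|exists s].
have i0 : 0 <= inf E by apply: lb_le_inf; [exact: Elb.1|move=> _ [s s0 <-]; exact: f0].
exists (inf E) => //; apply/cvgrPdist_le => e e0.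
have e20 : 0 < e / 2 by rewrite divr_gt0.
have [_ [s /= s0 <-] fs] := inf_adherent e20 Elb.
have fs0 := f0 s s0.
have d0 : 0 < (e / 2) / (f s + 1) by rewrite divr_gt0// ltr_pwDr.
have [d dp dn] := exp_small n d0.
near=> S.
have S0 : 0 < S by near: S; exact: nbhs_pinfty_gt.
have Ssd : s / d <= S by near: S; apply: nbhs_pinfty_ge; rewrite num_real.
rewrite distrC ger0_norm ?subr_ge0 ?infE//.
have h1 : f S <= f s * (1 + d) ^+ n.
  apply: (le_trans (fS s S s0 S0)); apply: ler_wpM2l => //.
  have sS : 0 <= s / S by rewrite divr_ge0// ltW.
  apply: lerXn2r; [by rewrite nnegrE addr_ge0|by rewrite nnegrE addr_ge0// ltW|].
  by rewrite lerD2l ler_pdivrMr// mulrC -ler_pdivrMr.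
have h2 : f s * (1 + d) ^+ n <= f s + e / 2.
  apply: (le_trans (ler_wpM2l fs0 dn)); rewrite mulrDr mulr1 lerD2l.
  rewrite mulrCA; apply: ler_piMr (ltW e20) _.
  by rewrite ler_pdivrMr ?ltr_pwDr// mul1r lerDl.
by move: fs h1 h2; clear; lra.
Unshelve. all: by end_near. Qed.

Lemma exists_min_cover A K : (exists N, covered_by_translates A K N) ->
  exists2 N, covered_by_translates A K N &
    forall M, covered_by_translates A K M -> (N <= M)%N.
Proof.
move=> [N AN]; have ex : exists N, `[< covered_by_translates A K N >].
  by exists N; exact/asboolP.
case: (ex_minnP ex) => m /asboolP Am mmin; exists m => // M /asboolP; exact: mmin.
Qed.

Lemma ereal_inf_cover (P : nat -> Prop) (g : nat -> \bar R) N : P N ->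
  (forall M, P M -> (g N <= g M)%E) -> ereal_inf [set g M | M in P] = g N.
Proof.
move=> PN gN; apply/eqP; rewrite eq_le; apply/andP; split.
  by apply: ereal_inf_lbound; exists N.
by apply: le_ereal_inf_tmp => _ [M PM <-]; exact: gN.
Qed.

(** Subdividing a large cube into smaller ones shows that the densities converge to their infimum
    over s, so for each d the cover of a single cube already bounds the limit. *)
Lemma covering_density_le K v rho : (0 <= rho) -> 0 < v -> (volume K <= v%:E)%E ->
  (forall d, 0 < d -> exists2 s0, 0 < s0 & forall s, s0 <= s -> exists2 N,
    covered_by_translates (cube s) K N &
    N%:R * v <= rho * (2 * s) ^+ n * (1 + d) ^+ (2 * n + 2)) ->
  cvg (cube_covering_density K s @[s --> +oo]) /\
  (covering_density K <= rho%:E)%E.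
Proof.
move=> rho0 v0 Kv H.
have volK0 := volume_ge0 K.
have [vol volE] : exists vol, volume K = vol%:E.
  exists (fine (volume K)); rewrite fineK// ge0_fin_numE//.
  by apply: le_lt_trans Kv _; exact: ltry.
have vol0 : 0 <= vol by move: volK0; rewrite volE lee_fin.
have volv : vol <= v by move: Kv; rewrite volE lee_fin.
have exN s : exists N, covered_by_translates (cube s) K N.
  have [s0 s00 /(_ (Num.max s0 s))] := H 1 ltr01.
  rewrite le_max lexx => /(_ isT)[N cN _]; exists N.
  by apply: covered_sub cN; apply: cube_sub; rewrite le_max lexx orbT.
have /choice[N0 N0P] : forall s, exists N, covered_by_translates (cube s) K N /\
    forall M, covered_by_translates (cube s) K M -> (N <= M)%N.
  by move=> s; have [N ? ?] := exists_min_cover (exN s); exists N.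
pose f s := vol * ((N0 s)%:R / (2 * s) ^+ n).
have FE s : 0 < s -> cube_covering_density K s = (f s)%:E.
  move=> s0; have [c1 c2] := N0P s.
  rewrite /cube_covering_density (ereal_inf_cover c1) => [|M /c2 NM].
    by rewrite volE -EFinM.
  rewrite volE -!EFinM lee_fin; apply: ler_wpM2l => //.
  by rewrite ler_pM2r ?ler_nat// invr_gt0 exprn_gt0// mulr_gt0.
have f0 s : 0 < s -> 0 <= f s.
  by move=> s0; rewrite mulr_ge0// divr_ge0// exprn_ge0// mulr_ge0// ltW.
have fS s S : 0 < s -> 0 < S -> f S <= f s * (1 + s / S) ^+ n.
  move=> s0 S0; pose k := (Num.truncn (S / s)).+1.
  have kS : S < k%:R * s by rewrite -ltr_pdivrMr// truncnS_gt.
  have /(_ _ (covered_cube_grid s0 (ltW S0) kS (N0P s).1)) NN := (N0P S).2.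
  have k0 : k%:R <= S / s + 1 by rewrite -natr1 lerD2r truncn_le// divr_ge0// ltW.
  have s20 : 0 < (2 * s) ^+ n by rewrite exprn_gt0// mulr_gt0.
  have S20 : 0 < (2 * S) ^+ n by rewrite exprn_gt0// mulr_gt0.
  rewrite /f -mulrA; apply: ler_wpM2l => //.
  have -> : (1 + s / S) ^+ n = (S / s + 1) ^+ n * ((2 * s) ^+ n / (2 * S) ^+ n).
    rewrite -expr_div_n -exprMn; congr (_ ^+ n); field.
    by rewrite !gt_eqF.
  rewrite mulrCA -mulrA [_^-1 * _]mulrA mulVf ?gt_eqF// mul1r mulrA.
  rewrite ler_pM2r ?invr_gt0//.
  apply: (@le_trans _ _ ((k ^ n * N0 s)%:R)); first by rewrite ler_nat.
  rewrite natrM natrX; apply: ler_wpM2r => //; apply: lerXn2r k0.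
    by rewrite nnegrE.
  by rewrite nnegrE addr_ge0// divr_ge0// ltW.
have [l fl lf] := cvg_covering_function f0 fS.
have Fl : cube_covering_density K s @[s --> +oo] --> l%:E.
  apply: cvg_EFin.
    by near=> s; rewrite FE//; near: s; exact: nbhs_pinfty_gt.
  apply: cvg_trans fl; apply: near_eq_cvg; near=> s.
  by rewrite /= FE//; near: s; exact: nbhs_pinfty_gt.
split; first by apply/cvg_ex; exists l%:E.
rewrite /covering_density (cvg_lim _ Fl)// lee_fin.
apply: (ler_mul1Dexp (k := 2 * n + 2)) => // d d0.
have [s s0 /(_ s (lexx _))[N cN NR]] := H d d0.
apply: (le_trans (lf s s0)).
have s20 : 0 < (2 * s) ^+ n by rewrite exprn_gt0// mulr_gt0.
rewrite /f mulrA ler_pdivrMr// mulrAC; apply: le_trans NR.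
rewrite mulrC; apply: ler_pM => //.
by rewrite ler_nat; exact: (N0P s).2.
Unshelve. all: by end_near. Qed.

End CoverDensity.

(** * Hadwiger numbers *)

Section Hadwiger.
Variables (R : realType) (n : nat).
Implicit Types (A B K : set 'rV[R]_n) (c x : 'rV[R]_n).

Lemma rogers_fun_gt0 k (x : R) : 0 < x < 1 -> 0 < rogers_fun k x.
Proof.
move=> /andP[x0 x1]; apply: lt_le_trans (rogers_fun_ge1 k x0 (ltW x1)).
have l0 : k%:R * ln x <= 0 by rewrite mulr_ge0_le0// ln_le0// ltW.
by rewrite subr_gt0 (le_lt_trans l0).
Qed.

Lemma scale_interior A l : body A -> 0 < l < 1 -> scale l A `<=` A°.
Proof.
move=> bA /andP[l0 l1] x lx; have [_ [r r0 rA] _] := bA.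
have l1' : 0 < 1 - l by rewrite subr_gt0.
apply/interior_cube; exists ((1 - l) * r); first by rewrite mulr_gt0.
move=> y; rewrite -scale_cube// => /(scaleS rA) Ay.
by rewrite -(scale1 A) -(subrK l 1) addrC; apply: scaleD.
Qed.

(** The large cube is covered by translates of A / (1 + d), which lies in the interior of A. The
    exponent is n for the content of this copy, 2n + 2 from [rogers_cover], n for replacing s by s -
    b, and 2n + 1 from [translative_cover]. *)
Lemma interior_cover A v B w eta d : (0 < n)%N -> body A -> has_content A v ->
  0 < eta < 1 -> (forall x, A x -> A (- eta *: x)) ->
  body B -> has_content B w -> (forall x y, A x -> A y -> B (x - y)) -> 0 < d ->
  exists2 M, covered_by_translates A (A°) M &
    M%:R <= rogers_fun n eta * w / v * (1 + d) ^+ (6 * n + 3).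
Proof.
move=> n0 bA cv eta01 Aeta bB cw AB d0.
have [v0 _] := cv; have [w0 _] := cw.
have d1 : 0 < 1 + d by rewrite addr_gt0.
pose l := (1 + d)^-1.
have l0 : 0 < l by rewrite invr_gt0.
have l1 : l < 1 by rewrite invf_lt1// ltrDl.
have bL := body_scale l0 bA; have cL := has_content_scale l0 cv.
have Leta x : scale l A x -> scale l A (- eta *: x).
  by rewrite /scale /= scalerA mulrC -scalerA; exact: Aeta.
have LA : scale l A `<=` A.
  by move=> x /(scale_sub bA l0 (ltW l1)); rewrite scale1.
have [s0 s00 H] := rogers_cover n0 bL cL eta01 Leta d0.
have [_ _ [b1 Ab1]] := bA.
pose b := `|b1|; have b0 : 0 <= b := normr_ge0 _.
have Ab : A `<=` cube b by apply: (subset_trans Ab1); apply: cube_sub; exact: ler_norm.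
(* Large enough for s <= (1 + d) (s - b); the summand 1 makes s > b strict. *)
pose s := Num.max s0 (b * (1 + d) / d + 1).
have ss : s0 <= s by rewrite le_max lexx.
have [N cN NR] := H s ss.
have sb : b * (1 + d) / d + 1 <= s by rewrite le_max lexx orbT.
have sb' : b * (1 + d) < (s - 1 / 2) * d.
  by rewrite -ltr_pdivrMr//; move: sb; clear; lra.
have bs : b < s.
  have bd : b * (1 + d) < s * d.
    by apply: lt_trans sb' _; rewrite ltr_pM2r//; clear; lra.
  by rewrite -(ltr_pM2r d0); apply: le_lt_trans bd; rewrite mulrDr mulr1 lerDr.
have e0 : 0 < s - b by rewrite subr_gt0.
have [M cM MR] := translative_cover Ab bs cN bB cw (fun x y Lx Ay => AB x y (LA x Lx) Ay) d0.
exists M.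
  have [t tA] := cM; exists t => x /tA[j _ [y Ly yx]]; exists j => //.
  by exists y => //; apply: scale_interior Ly => //; rewrite l0.
have P2 : 0 < (2 * (s - b)) ^+ n by rewrite exprn_gt0// mulr_gt0.
have lv0 : 0 < l ^+ n * v by rewrite mulr_gt0// exprn_gt0.
have D k : 0 < (1 + d) ^+ k by rewrite exprn_gt0.
have sE : (2 * s) ^+ n <= (2 * (s - b)) ^+ n * (1 + d) ^+ n.
  rewrite -exprMn; apply: lerXn2r.
  - by rewrite nnegrE mulr_ge0// (le_trans b0)// ltW.
  - by rewrite nnegrE mulr_ge0 ?(ltW d1)// mulr_ge0 ?(ltW e0).
  - by move: sb' d0; clear; lra.
have F0 := rogers_fun_gt0 n eta01.
have N2 : N%:R <= rogers_fun n eta * ((2 * (s - b)) ^+ n * (1 + d) ^+ n)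
     * (1 + d) ^+ (2 * n + 2) * ((1 + d) ^+ n / v).
  have -> : (1 + d) ^+ n / v = (l ^+ n * v)^-1 by rewrite invfM /l exprVn invrK.
  rewrite ler_pdivlMr//; apply: (le_trans NR).
  by rewrite ler_pM2r// ler_pM2l.
rewrite -(ler_pM2r P2); apply: (le_trans MR).
apply: (@le_trans _ _ (rogers_fun n eta * ((2 * (s - b)) ^+ n * (1 + d) ^+ n)
     * (1 + d) ^+ (2 * n + 2) * ((1 + d) ^+ n / v) * w * (1 + d) ^+ (2 * n + 1))).
  by rewrite ler_pM2r// ler_pM2r.
have -> : rogers_fun n eta * w / v * (1 + d) ^+ (6 * n + 3) * (2 * (s - b)) ^+ n
  = rogers_fun n eta * ((2 * (s - b)) ^+ n * (1 + d) ^+ n)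
     * (1 + d) ^+ (2 * n + 2) * ((1 + d) ^+ n / v) * w * (1 + d) ^+ (2 * n + 1).
  have -> : (1 + d) ^+ (6 * n + 3)
      = (1 + d) ^+ n * (1 + d) ^+ (2 * n + 2) * (1 + d) ^+ n * (1 + d) ^+ (2 * n + 1).
    have e6 : (6 * n + 3 = n + (2 * n + 2) + n + (2 * n + 1))%N.
      by clear; lia.
    by rewrite e6 (exprD _ (n + _ + n)) (exprD _ (n + _) n) (exprD _ n (2 * n + 2)).
  move: (rogers_fun n eta) ((2 * _) ^+ n) ((1 + d) ^+ _) (_ ^+ (2 * n + 2)).
  by move=> f p p1 p2; move: (_ ^+ (2 * n + 1)) => p3; ring.
by [].
Qed.

Lemma translateK c K : translate c (translate (- c) K) = K.
Proof. by apply/funext => x; rewrite /translate /= opprK subrK. Qed.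

Lemma interior_translate c K : (translate (- c) K)° `<=` translate (- c) (K°).
Proof.
move=> x /interior_cube[r r0 H]; apply/interior_cube; exists r => // y yr.
by have := H y yr; rewrite /translate /= !opprK addrAC.
Qed.

(** X stands for the bound on the ratio of contents of B and A, to be taken as the central binomial
    coefficient or as 2^n. *)
Lemma covering_number_interior_le K c v B w eta X : (0 < n)%N ->
  let A := translate (- c) K in
  body A -> has_content A v -> 0 < eta < 1 -> (forall x, A x -> A (- eta *: x)) ->
  body B -> has_content B w -> (forall x y, A x -> A y -> B (x - y)) ->
  w <= X * v ->
  (covering_number K (K°) <= (X * rogers_fun n eta)%:E)%E.
Proof.
move=> n0 A bA cv eta01 Aeta bB cw AB wX.
have [v0 _] := cv; have [w0 _] := cw; have F0 := rogers_fun_gt0 n eta01.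
have X0 : 0 <= X by rewrite -(pmulr_lge0 _ v0) (le_trans (ltW w0)).
apply: (le_EFin_mul1Dexp (k := 6 * n + 3)) => [|d d0].
  by rewrite mulr_ge0// ltW.
have [M cM MR] := interior_cover n0 bA cv eta01 Aeta bB cw AB d0.
apply: (@le_trans _ _ (M%:R)%:E).
  apply: ereal_inf_lbound; exists M => //.
  rewrite -{1}(translateK c K); apply: covered_translate_left.
  apply: (@covered_translate _ _ _ _ (- c)).
  have [t tA] := cM; exists t => x /tA[j _ [y Ay yx]]; exists j => //.
  by exists y => //; exact: interior_translate.
rewrite lee_fin; apply: (le_trans MR); rewrite ler_pM2r ?exprn_gt0 ?addr_gt0//.
rewrite -mulrA mulrC; apply: ler_wpM2r; first exact: ltW.
by rewrite ler_pdivrMr.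
Qed.

(** Attainment of the Hadwiger numbers comes from integrality: a nonempty bounded set of natural
    numbers has a greatest element. *)
Lemma ereal_sup_nat_max (S : set (\bar R)) (X : R) : S !=set0 ->
  (forall e, S e -> exists N : nat, e = N%:R%:E) -> (forall e, S e -> (e <= X%:E)%E) ->
  is_maximum S (ereal_sup S) /\ (ereal_sup S <= X%:E)%E.
Proof.
move=> [e0 Se0] SN SX.
have [N0 N0E] := SN _ Se0.
have ex : exists N : nat, `[< S N%:R%:E >] by exists N0; apply/asboolP; rewrite -N0E.
have ub (N : nat) : `[< S N%:R%:E >] -> (N <= Num.truncn X)%N.
  move=> /asboolP /SX; rewrite lee_fin => NX.
  by rewrite truncn_ge_nat// (le_trans _ NX).
case: (ex_maxnP ex ub) => m /asboolP Sm mmax.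
have mub : ubound S m%:R%:E.
  move=> e Se; have [N NE] := SN _ Se; rewrite NE lee_fin ler_nat; apply: mmax.
  by apply/asboolP; rewrite -NE.
have E : ereal_sup S = m%:R%:E.
  by apply/eqP; rewrite eq_le ge_ereal_sup//= ereal_sup_ubound.
by rewrite E; split; [split|exact: SX].
Qed.

Lemma covering_number_nat A K (X : R) : (covering_number A K <= X%:E)%E ->
  exists N : nat, covering_number A K = N%:R%:E.
Proof.
move=> H; have [[N cN]|ne] := pselect (exists N, covered_by_translates A K N).
  have [M cM Mmin] := exists_min_cover (ex_intro _ N cN); exists M.
  by apply: ereal_inf_cover cM _ => M' /Mmin; rewrite lee_fin ler_nat.
move: H; rewrite /covering_number (_ : [set _ | _ in _] = set0) ?ereal_inf0 ?leye_eq//.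
by apply/seteqP; split => // e [N cN _]; apply: ne; exists N.
Qed.

Lemma cube_convex_body : convex_body R n (cube 1).
Proof.
split.
- have key (t a b : R) : 0 <= t -> t <= 1 -> -1 <= a <= 1 -> -1 <= b <= 1 ->
      -1 <= t * a + (1 - t) * b <= 1.
    move=> t0 t1 /andP[a1 a2] /andP[b1 b2].
    have ta1 := ler_wpM2l t0 a1; have ta2 := ler_wpM2l t0 a2.
    have s0 : 0 <= 1 - t by rewrite subr_ge0.
    have tb1 := ler_wpM2l s0 b1; have tb2 := ler_wpM2l s0 b2.
    by apply/andP; split; lra.
  move=> x y l; rewrite !inE => xc yc i; rewrite !mxE.
  by apply: key => //; exact: xc i.
- have H := @rV_compact R n (fun=> `[-1, 1]%classic) (fun=> @segment_compact R (-1) 1).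
  by move: H; congr compact; apply/seteqP; split=> v vc i; have := vc i; rewrite /= in_itv.
- by exists 0; apply/interior_cube; exists 1 => // x; rewrite add0r.
Qed.

Lemma cube_symmetric_convex_body : symmetric_convex_body R n (cube 1).
Proof.
split; first exact: cube_convex_body.
by exists 0 => x xc i; rewrite scaler0 sub0r; exact: opp_cube.
Qed.

End Hadwiger.

Lemma rogers_bound_minimum (R : realType) n : (3 <= n)%N ->
  is_minimum (rogers_values R n) (rogers_bound R n) /\
  exists2 eta : R, 0 < eta < n%:R^-1 & rogers_bound R n = rogers_fun n eta.
Proof.
move=> n3; have [x xn xmin] := rogers_fun_min R n3.
have Sx : rogers_values R n (rogers_fun n x) by exists x => //=; rewrite in_itv.
have lb : lbound (rogers_values R n) (rogers_fun n x).
  by move=> e [y /=]; rewrite in_itv /= => yn <-; exact: xmin.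
have E : rogers_bound R n = rogers_fun n x.
  apply/eqP; rewrite eq_le; apply/andP; split.
    by apply: ge_inf => //; exists (rogers_fun n x).
  by apply: lb_le_inf => //; exists (rogers_fun n x).
by rewrite E; split; [split|exists x].
Qed.

Theorem proposition7 (R : realType) (n : nat) (hn : (3 <= n)%N) :
  [/\ is_minimum (rogers_values R n) (rogers_bound R n),
      forall K : set 'rV[R]_n, convex_body R n K ->
        cvg (cube_covering_density K s @[s --> +oo]) /\
        (covering_density K <= (rogers_bound R n)%:E)%E,
      is_maximum (interior_covering_numbers (convex_body R n)) (hadwiger_number R n)
        /\ (hadwiger_number R n <= ('C(2 * n, n)%:R * rogers_bound R n)%:E)%E &
      is_maximum (interior_covering_numbers (symmetric_convex_body R n))
          (symmetric_hadwiger_number R n)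
        /\ (symmetric_hadwiger_number R n
              <= (2%:R ^+ n * rogers_bound R n)%:E)%E].
Proof.
have n0 : (0 < n)%N by apply: leq_trans hn.
have [rmin [eta /andP[eta0 etan] rE]] := rogers_bound_minimum R hn.
have nR : 0 < n%:R :> R by rewrite ltr0n.
have neta : n%:R * eta < 1 by rewrite mulrC -ltr_pdivlMr// div1r.
have eta1 : eta < 1 by apply: (lt_le_trans etan); rewrite invf_le1// ler1n.
have eta01 : 0 < eta < 1 by rewrite eta0.
have F0 := rogers_fun_gt0 n eta01.
have center (K : set 'rV[R]_n) : convex_body R n K -> exists c, body (translate (- c) K) /\
    forall x, translate (- c) K x -> translate (- c) K (- eta *: x).
  move=> [/convex_setE cK /compact_cube bK iK].
  exact: exists_center cK bK iK eta0 neta.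
have bound (K : set 'rV[R]_n) : convex_body R n K ->
    (covering_number K (K°) <= ('C(2 * n, n)%:R * rogers_bound R n)%:E)%E.
  move=> /center[c [bA Aeta]]; rewrite rE.
  have [v cv] := body_content bA; have bB := body_difference bA.
  have [w cw] := body_content bB.
  apply: (covering_number_interior_le n0 bA cv eta01 Aeta bB cw).
    by move=> x y Ax Ay; exists x, y.
  exact: rogers_shephard n0 bA cv cw.
have sbound (K : set 'rV[R]_n) : symmetric_convex_body R n K ->
    (covering_number K (K°) <= (2%:R ^+ n * rogers_bound R n)%:E)%E.
  move=> [[/convex_setE cK /compact_cube[b bK] [a /interior_cube[r r0 aK]]] [c cs]].
  (* Here the center of symmetry replaces the centroid of a simplex: A = - A contains 0, hence also
     - eta A, and its differences lie in 2 A. *)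
  rewrite rE; pose A := translate (- c) K.
  have tE x : A x = K (x + c) by rewrite /A /translate /= opprK.
  have An x : A x -> A (- x).
    rewrite !tE => /cs; have -> : 2%:R *: c - (x + c) = - x + c; last by [].
    by rewrite scaler_nat mulr2n opprD addrCA addrK.
  have cA : segment_closed A.
    move=> x y t; rewrite !tE => Kx Ky t01.
    have -> : t *: x + (1 - t) *: y + c = t *: (x + c) + (1 - t) *: (y + c).
      by rewrite !scalerDr addrACA -scalerDl [t + _]addrC subrK scale1r.
    exact: cK.
  have Ab : exists b, A `<=` @cube R n b by apply: translate_bounded; exists b.
  have aA x : cube r x -> A ((a - c) + x).
    by move=> xr; rewrite tE addrAC subrK; exact: aK.
  have A0 : A 0.
    have Aa : A (a - c) by rewrite -[a - c]addr0; apply: aA => i; rewrite mxE oppr_le0 (ltW r0).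
    have := cA _ _ (1 / 2) Aa (An _ Aa).
    have -> : 1 / 2 *: (a - c) + (1 - 1 / 2) *: - (a - c) = 0.
      by apply/rowP => i; rewrite !mxE; field.
    by apply; lra.
  have Aeta x : A x -> A (- eta *: x).
    move=> /An Ax; have := cA _ _ eta Ax A0.
    rewrite scaler0 addr0 scalerN scaleNr; apply.
    by rewrite !ltW.
  have bA : body A := neg_closed_body cA Ab r0 aA eta0 Aeta.
  have [v cv] := body_content bA.
  apply: (covering_number_interior_le n0 bA cv eta01 Aeta (body_scale _ bA)
    (has_content_scale (ltr0n _ 2 : 0 < 2%:R) cv)) => //.
  move=> x y Ax /An Ay; rewrite -[2%:R]/(1 + 1); apply: scaleD => //; by rewrite scale1.
split=> //.
- move=> K /center[c [bA Aeta]]; have [v cv] := body_content bA.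
  have [v0 _] := cv; rewrite rE.
  apply: (covering_density_le (v := v)) => //; first exact: ltW.
    by rewrite -(translateK c K); exact: volume_le_content.
  move=> d d0; have [s0 s00 H] := rogers_cover n0 bA cv eta01 Aeta d0.
  exists s0 => // s /H[N cN NR]; exists N => //.
  exact: covered_translate cN.
- apply: ereal_sup_nat_max.
  + by eexists; exists (cube 1) => //; exact: cube_convex_body.
  + by move=> _ [K /bound + <-]; exact: covering_number_nat.
  + by move=> _ [K /bound + <-].
- apply: ereal_sup_nat_max.
  + by eexists; exists (cube 1) => //; exact: cube_symmetric_convex_body.
  + by move=> _ [K /sbound + <-]; exact: covering_number_nat.
  + by move=> _ [K /sbound + <-].
Qed.
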